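(* Let $\mathbf{F}/\mathbb{F}_q$ be an algebraic function field of genus $g$ with constant field $\mathbb{F}_q$, let $L(t)=\sum_{i=0}^{2g}a_it^i$ be its $L$-polynomial, and let $S_r:=N_r-(q^r+1)$ for $r\ge 1$. For $i=1,\ldots,g$, the following equations are equivalent: (a) $$a_i=\frac1i\sum_{j=1}^{\infty}S_j\,a_{i-j},$$ where $a_0=1$ and $a_k=0$ for $k<0$. (b) $$a_i=\mathrm{pper}\begin{pmatrix} S_1 & & & & \\ \frac{S_2}{S_1} & \frac{S_1}{2} & & & \\ \frac{S_3}{S_2} & \frac{S_2}{S_1} & \frac{S_1}{3} & & \\ \vdots & \vdots & \vdots & \ddots & \\ \frac{S_i}{S_{i-1}} & \frac{S_{i-1}}{S_{i-2}} & \frac{S_{i-2}}{S_{i-3}} & \cdots & \frac{S_1}{i}\end{pmatrix},$$ i.e. the parapermanent of the triangular matrix $(b_{n,j})_{1\le j\le n\le i}$ with $b_{n,j}=S_{n+1-j}/S_{n-j}$ for $j<n$ and $b_{n,n}=S_1/n$. (c) $$a_i=\sum_{(m_1,\ldots,m_r)\in\mathbb{P}(i)}\ \prod_{s=1}^{r}\frac{S_{m_s}}{m_1+\cdots+m_s}=\sum_{(m_1,\ldots,m_r)\in\mathbb{P}(i)}\ \prod_{s=1}^{r}\frac{N_{m_s}-(q^{m_s}+1)}{m_1+\cdots+m_s}.$$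
   Context: The $L$-polynomial $L(t)=\sum_{i=0}^{2g}a_it^i$ of $\mathbf{F}/\mathbb{F}_q$ is the numerator of its Zeta function. For $r\ge1$, $N_r$ is the number of places of degree one of the constant field extension $\mathbf{F}\,\mathbb{F}_{q^r}$ of degree $r$. $\mathbb{P}(n)$ denotes the set of compositions of the positive integer $n$, i.e. of all tuples $(m_1,\ldots,m_r)$ ($r\ge1$ arbitrary) of positive integers with $m_1+\cdots+m_r=n$; order matters. For a triangular matrix $B_n=(b_{i,j})_{1\le j\le i\le n}$, the factorial product of the element $b_{i,j}$ is $\{b_{i,j}\}=\prod_{k=j}^{i}b_{i,k}$, and the parapermanent of $B_n$ is $$\mathrm{pper}(B_n)=\sum_{r=1}^{n}\ \sum_{m_1+\cdots+m_r=n}\ \prod_{s=1}^{r}\{b_{m_1+\cdots+m_s,\;m_1+\cdots+m_{s-1}+1}\},$$ where the inner sum is over compositions of $n$ into $r$ positive parts (the empty sum is $0$ when $s=1$); by definition $\mathrm{pper}(B_0)=1$. For the matrix in (b), the factorial products are understood after formal cancellation, i.e. $\{b_{n,j}\}=S_{n+1-j}/n$; this is the meaning of (b) also when some $S_k$ vanishes. *)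

(* Defs.v *)
From HB Require Import structures.
From mathcomp Require Import all_boot all_order all_algebra.
From mathcomp Require Import finmap.
From mathcomp Require Import all_classical.

Set Implicit Arguments.
Unset Strict Implicit.
Unset Printing Implicit Defensive.

Import Order.TTheory GRing.Theory Num.Theory.

Local Open Scope classical_set_scope.
Local Open Scope card_scope.
Local Open Scope ring_scope.

(** * Algebraic function fields of one variable

An extension F/K is given by a morphism of fields [iota : K -> F]. *)

Section FunctionField.
Variables (K F : fieldType) (iota : {rmorphism K -> F}).

(* The subfield K(x) of F, for x transcendental over K. *)
Definition rational_subfield (x : F) : set F :=
  [set y | exists p r : {poly K}, (map_poly iota r).[x] != 0 /\
           y = (map_poly iota p).[x] / (map_poly iota r).[x]].

Definition is_function_field : Prop :=
  exists x : F, ~ algebraicOver iota x /\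
    exists (n : nat) (v : 'I_n -> F), forall y : F,
      exists c : 'I_n -> F, (forall i, rational_subfield x (c i)) /\
        y = \sum_i c i * v i.

Definition is_full_constant_field : Prop :=
  forall z : F, algebraicOver iota z -> exists c : K, z = iota c.

(* For K-subspaces W <= V of F, the K-dimension of V/W: v is a lift to V of a
   basis of V/W. The default value 0 is returned when V/W is not
   finite-dimensional; this occurs in none of the uses below when F/K is a
   function field. *)
Definition is_quotient_basis (V W : set F) n (v : 'I_n -> F) : Prop :=
  (forall i, V (v i)) /\
  forall x, V x ->
    exists! c : {ffun 'I_n -> K}, W (x - \sum_i iota (c i) * v i).

Definition quotient_dim (V W : set F) : nat :=
  xget 0%N [set n | exists v : 'I_n -> F, is_quotient_basis V W v].

Definition is_valuation_ring (O : set F) : Prop :=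
  [/\ forall c, O (iota c),
      forall x y, O x -> O y -> O (x - y),
      forall x y, O x -> O y -> O (x * y),
      exists z, ~ O z &
      forall z, z != 0 -> O z \/ O z^-1].

(* A place is the maximal ideal of a valuation ring of F/K. The two determine
   each other, and a place is represented here by its valuation ring. *)
Record place := Place {
  place_ring : set F ;
  place_ringP : is_valuation_ring place_ring }.

HB.instance Definition _ := gen_eqMixin place.
HB.instance Definition _ := gen_choiceMixin place.

Definition place_ideal (P : place) : set F :=
  [set x | place_ring P x /\ (x = 0 \/ ~ place_ring P x^-1)].

Definition place_degree (P : place) : nat :=
  quotient_dim (place_ring P) (place_ideal P).

Definition is_uniformizer (P : place) (t : F) : Prop :=
  [/\ t != 0, place_ideal P t &
      forall y, place_ideal P y -> place_ring P (y / t)].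

(* The discrete valuation v_P, on nonzero elements. *)
Definition place_val (P : place) (x : F) : int :=
  xget 0 [set n : int | exists t u : F,
    [/\ is_uniformizer P t, place_ring P u, ~ place_ideal P u
      & x = t ^ n * u]].

Definition divisor : Type := {fsfun place -> int with 0}.

Definition div_degree (D : divisor) : int :=
  \sum_(P <- finsupp D) D P * (place_degree P)%:Z.

Definition effective (D : divisor) : Prop := forall P : place, 0 <= D P.

Definition RR_space (D : divisor) : set F :=
  [set x | x = 0 \/ forall P : place, 0 <= place_val P x + D P].

Definition RR_dim (D : divisor) : nat := quotient_dim (RR_space D) [set 0].

Definition is_genus (g : nat) : Prop :=
  (exists D : divisor, div_degree D - (RR_dim D)%:Z + 1 = g%:Z) /\
  (forall D : divisor, div_degree D - (RR_dim D)%:Z + 1 <= g%:Z).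

(* The n-th coefficient of the Zeta function Z(t) = \sum_n A_n t^n counts the
   effective divisors of degree n. *)
Definition is_zeta_coefs (A : nat -> nat) : Prop :=
  forall n : nat,
    [set D : divisor | effective D /\ div_degree D = n%:Z] #= `I_(A n).

(* L(t) = (1 - t) (1 - q t) Z(t), as a product of formal power series. *)
Definition is_L_polynomial (q : nat) (L : {poly rat}) : Prop :=
  exists2 A : nat -> nat, is_zeta_coefs A &
    forall n : nat,
      L`_n = \sum_(j < n.+1)
        ((1 - 'X) * (1 - q%:R *: 'X) : {poly rat})`_j * (A (n - j)%N)%:R.

End FunctionField.

(** * Constant field extensions of a function field over a finite field *)

(* The constant field extension of degree r, F.k' with [k' : k] = r: the field
   [ce_field] is generated by the images of F and of k' = [ce_const]. *)
Record constant_extension (k : finFieldType) (F : fieldType)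
    (iota : {rmorphism k -> F}) (r : nat) := ConstantExtension {
  ce_const : finFieldType ;
  ce_field : fieldType ;
  ce_iota : {rmorphism ce_const -> ce_field} ;
  ce_base : {rmorphism k -> ce_const} ;
  ce_incl : {rmorphism F -> ce_field} ;
  ce_comm : forall c : k, ce_incl (iota c) = ce_iota (ce_base c) ;
  ce_card : #|ce_const| = (#|k| ^ r)%N ;
  ce_gen : forall E : {pred ce_field}, GRing.divring_closed E ->
    (forall x, ce_incl x \in E) -> (forall c, ce_iota c \in E) ->
    forall z, z \in E }.

(* n is the number of places of degree one of F.k', [k' : k] = r; the constant
   field extension of degree r is unique up to isomorphism. *)
Definition is_num_degree_one_places (k : finFieldType) (F : fieldType)
    (iota : {rmorphism k -> F}) (r n : nat) : Prop :=
  exists E : constant_extension iota r,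
    [set P : place (ce_iota E) | place_degree P = 1%N] #= `I_n.

(** * Compositions and parapermanents *)

Definition compositions (n : nat) : set (seq nat) :=
  [set m | [/\ m <> [::], all (fun x => 0 < x)%N m & sumn m = n]].

(* m_1 + ... + m_s *)
Definition psum (m : seq nat) (s : nat) : nat := sumn (take s m).

Section Parapermanent.
Variable R : fieldType.

(* Rows and columns are numbered from 1; only the b i j with 1 <= j <= i <= n
   are relevant. *)
Definition factorial_product (b : nat -> nat -> R) (i j : nat) : R :=
  \prod_(j <= k < i.+1) b i k.

(* The parapermanent as a function of the factorial products fp i j = {b_ij}.
   In the product s ranges over 0, ..., r - 1. *)
Definition pper_of_factorial_products (n : nat) (fp : nat -> nat -> R) : R :=
  if n == 0%N then 1 else
  \sum_(1 <= r < n.+1)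
    \sum_(m \in [set m | compositions n m /\ size m = r])
      \prod_(s < r) fp (psum m s.+1) (psum m s).+1.

Definition pper (n : nat) (b : nat -> nat -> R) : R :=
  pper_of_factorial_products n (factorial_product b).

Definition quotient_matrix (S : nat -> R) (n j : nat) : R :=
  if (j < n)%N then S (n.+1 - j)%N / S (n - j)%N else S 1%N / n%:R.

Definition cancelled_products (S : nat -> R) (n j : nat) : R :=
  S (n.+1 - j)%N / n%:R.

(* The parapermanent of [quotient_matrix S], its factorial products being
   understood after formal cancellation, so that no S_k is inverted. *)
Definition pper_cancelled (n : nat) (S : nat -> R) : R :=
  pper_of_factorial_products n (cancelled_products S).

(* The cancellation, valid when the S_k are invertible. *)
Lemma factorial_product_quotient_matrix (S : nat -> R) (n j : nat) :
  (0 < j <= n)%N -> (forall k, (0 < k <= n)%N -> S k != 0) ->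
  factorial_product (quotient_matrix S) n j = cancelled_products S n j.
Proof.
move=> /andP[j0 jn] Snz; rewrite /factorial_product /cancelled_products.
move: j0; rewrite -(subKn jn); have : (n - j <= n)%N by exact: leq_subr.
elim: (n - j)%N => [|d IHd] dn j0.
  by rewrite subn0 big_nat1 /quotient_matrix ltnn subSn // subnn.
have dn' : (d <= n)%N by exact: ltnW.
have Ed : (n - d = (n - d.+1).+1)%N by rewrite subnSK.
rewrite big_ltn; last by rewrite ltnS leq_subr.
rewrite -Ed IHd //; last by rewrite Ed.
rewrite /quotient_matrix ifT; last by rewrite -Ed leq_subr.
rewrite !subSn ?leq_subr // !subKn // mulrA divfK //.
by apply: Snz.
Qed.

Lemma pper_quotient_matrix (S : nat -> R) (n : nat) :
  (forall k, (0 < k <= n)%N -> S k != 0) ->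
  pper n (quotient_matrix S) = pper_cancelled n S.
Proof.
move=> Snz; rewrite /pper /pper_cancelled /pper_of_factorial_products.
case: eqP => // _; apply: eq_bigr => r _.
apply: eq_fsbigr => m /set_mem[[_ /allP mpos mn] <-].
apply: eq_bigr => s _.
have psumS : psum m s.+1 = (psum m s + nth 0 m s)%N.
  by rewrite /psum (take_nth 0%N) // sumn_rcons.
have le_n : (psum m s.+1 <= n)%N.
  by rewrite -mn -[in leqRHS](cat_take_drop s.+1 m) sumn_cat leq_addr.
apply: factorial_product_quotient_matrix.
  by rewrite /= psumS -addn1 leq_add2l mpos ?mem_nth.
by move=> l /andP[l0 ln]; apply: Snz; rewrite l0 (leq_trans ln).
Qed.

End Parapermanent.

(* The sequence a extended by a_k = 0 for k < 0. *)
Definition int_ext (a : nat -> rat) (k : int) : rat :=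
  if k is Posz n then a n else 0.

(* Main.v *)
Require Import Defs.
From HB Require Import structures.
From mathcomp Require Import all_boot all_order all_algebra.
From mathcomp Require Import finmap.
From mathcomp Require Import all_classical.
From mathcomp Require Import fingroup pgroup abelian cyclic finfield.
From mathcomp Require Import zify ring.
Import Order.TTheory GRing.Theory Num.Theory.
Local Open Scope classical_set_scope.
Local Open Scope ring_scope.

(** Each of the three equations holds for the L-polynomial of a function field,
so they are equivalent.

Let A n be the number of effective divisors of degree n, so that the Zeta
function is the power series with coefficients A n. Writing the degree of a
divisor as the sum of the degrees of its places with multiplicity, and counting
the effective divisors D of degree n with D P >= i by subtracting i P, one gets
  n A_n = sum over j = 1 .. n of M_j A_(n-j),
where M_j is the sum of the degrees of the places whose degree divides j
([zeta_recursion]). This is the coefficientwise form of t Z'(t) = M(t) Z(t).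

The number N_j of places of degree one of the constant field extension F.k'
of degree j is equal to M_j ([sum_degree_dvd_num_degree_one_places]), because
exactly deg P of them lie above a place P with deg P | j, and none lies above
any other place ([card_degree_one_places_above]). Indeed a place of degree one
above P restricts to an embedding over k of the residue field of P into k', and
such an embedding phi comes from exactly one place: if al generates k' over k,
then F.k' = F[al], and the localisation of O_P[al] at the kernel of its
specialisation to k' along phi is a valuation ring. To see this, lift a
generator of the residue field to some beta in O_P. With q = #|k| and
d = deg P, the powers beta^(q^(d n)) have the same residue and approximate the
root of the minimal polynomial of the generator in k' better and better
([beta_approxP]). Hence, up to a small error, an element of O_P[al] is a
combination over O_P of elements of k' that are linearly independent over the
residue field, and a coefficient of least value can be factored out
([realize_factor]). That the errors become small compared with any given
nonzero element of F is the archimedean property of the places of a function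
field, which holds since F has transcendence degree one ([place_archimedean]).

Multiplying Z(t) by (1 - t)(1 - q t) changes N_j into S_j = N_j - 1 - q^j in
the recursion ([newton_identities_mul_linear]); this is (a) for the
coefficients a_i. Unfolding (a) gives the sum over compositions in (c)
([comp_sum_newton_identities]): the last part of a composition is the index j
of the recursion. Sorting the compositions by length gives (b)
([pper_cancelledE]). *)

Set Implicit Arguments.
Unset Strict Implicit.
Unset Printing Implicit Defensive.

(** * Minimal polynomials over finite fields *)

Lemma annihilator_exists (k K : fieldType) (j : {rmorphism k -> K}) (z : K)
    (p : {poly k}) : p != 0 -> root (map_poly j p) z ->
  exists2 m : {poly k}, m \is monic & forall h, root (map_poly j h) z = (m %| h).
Proof.
move=> p0 rp.
pose ann (n : nat) := `[< exists2 h : {poly k}, h != 0 /\ size h = n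
  & root (map_poly j h) z >].
have ann_ex : exists n, ann n by exists (size p); apply/asboolP; exists p.
have [n /asboolP[h0 [h0n0 sh0] rh0] minn] := ex_minnP ann_ex.
pose m := (lead_coef h0)^-1 *: h0.
have lc0 : lead_coef h0 != 0 by rewrite lead_coef_eq0.
have mmon : m \is monic by rewrite monicE lead_coefZ mulVf.
have sm : size m = n by rewrite size_scale ?invr_eq0.
have rm : root (map_poly j m) z by rewrite map_polyZ /= rootZ // fmorph_eq0 invr_eq0.
exists m => // h.
apply/idP/idP=> [rh | /dvdpP[g ->]]; last by rewrite rmorphM /= rootM rm orbT.
apply: contraTT rh => ndv; apply/negP=> rh.
have : ann (size (h %% m)).
  apply/asboolP; exists (h %% m) => //.
  have E : h %% m = h - h %/ m * m by rewrite {2}(divp_eq h m) addrAC subrr add0r.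
  by rewrite E rmorphB rmorphM /= rootE !hornerE (eqP rh) (eqP rm) mulr0 subrr.
by move/minn; rewrite leqNgt -sm ltn_modp monic_neq0.
Qed.

(** A proper factor of m would vanish at z, or its cofactor would; the first is
associated to m, and the second has too small a degree. *)
Lemma annihilator_irreducible (k K : fieldType) (j : {rmorphism k -> K})
    (m : {poly k}) (z : K) :
  (forall h, root (map_poly j h) z = (m %| h)) -> m != 0 -> irreducible_poly m.
Proof.
move=> mP m0; have rm : root (map_poly j m) z by rewrite mP.
split; first by rewrite -(size_map_poly j) (root_size_gt1 _ rm) // map_poly_eq0.
move=> g sg gm; have /dvdpP[f Df] := gm.
have f0 : f != 0 by apply: contraNneq m0 => f0; rewrite Df f0 mul0r.
have g0 : g != 0 by apply: contraNneq m0 => g0; rewrite Df g0 mulr0.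
rewrite /eqp gm; move: rm; rewrite {1}Df rmorphM /= rootM => /orP[]; rewrite mP //.
move/(dvdp_leq f0); rewrite {1}Df size_mul //.
by have := size_poly_gt0 g; rewrite g0; move: sg; case: (size g) => [|[|n]] // _ _;
  rewrite !addnS /= -addSn leqNgt ltnS leq_addr.
Qed.

(** A generator z of the multiplicative group of K generates K over k. Every
element of K is uniquely a polynomial in z of degree less than deg m, so that
#|K| = #|k| ^ deg m, and this gives the degree of m. *)
Lemma finite_field_simple_extension (k K : finFieldType)
    (j : {rmorphism k -> K}) (d : nat) :
  #|K| = (#|k| ^ d)%N ->
  exists z : K, exists m : {poly k},
    [/\ m \is monic, size m = d.+1,
        forall h, root (map_poly j h) z = (m %| h) &
        forall y, exists2 h : {poly k}, (size h <= d)%N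
          & y = (map_poly j h).[z]].
Proof.
move=> cardK.
have /cyclicP[u Du] := field_unit_group_cyclic [set: {unit K}]%G.
pose z : K := FinRing.uval u.
have powz (y : K) : y != 0 -> exists n, y = z ^+ n.
  move=> y0; have yU : y \is a GRing.unit by rewrite unitfE.
  have : FinRing.Unit yU \in <[u]>%g by rewrite -Du inE.
  by case/cycleP=> n Dn; exists n; rewrite -FinRing.val_unitX -Dn.
have q1 := finNzRing_gt1 K.
have [||m mmon mP] := @annihilator_exists _ _ j z ('X^#|K| - 'X).
- by rewrite -size_poly_eq0 size_polyDl size_polyXn // size_polyN size_polyX ltnS.
- by rewrite rmorphB /= map_polyXn map_polyX rootE !hornerE expf_card subrr.
have rm : root (map_poly j m) z by rewrite mP.
pose n := size m; have sm : size m = n by [].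
have surj y : exists2 h : {poly k}, (size h <= n.-1)%N & y = (map_poly j h).[z].
  have [h ->] : exists h : {poly k}, y = (map_poly j h).[z].
    have [->|/powz[e ->]] := eqVneq y 0.
      by exists 0; rewrite map_poly0 horner0.
    by exists 'X^e; rewrite map_polyXn hornerXn.
  exists (h %% m).
    have := ltn_modp h m; rewrite monic_neq0 // sm => lt.
    by rewrite -ltnS prednK //; case: (n) lt.
  rewrite {1}(divp_eq h m) rmorphD rmorphM /= !hornerE.
  by rewrite (eqP rm) mulr0 add0r.
have ngt0 : (0 < n)%N.
  by rewrite -sm size_poly_gt0 monic_neq0.
suff En : n.-1 = d by exists z, m; split=> //; rewrite ?sm -?En ?prednK.
pose ev (c : {ffun 'I_n.-1 -> k}) : K := \sum_i j (c i) * z ^+ i.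
have evP (c : {ffun 'I_n.-1 -> k}) :
    ev c = (map_poly j (\poly_(i < n.-1) (if insub i is Some i' then c i' else 0))).[z].
  rewrite (@horner_coef_wide _ n.-1); last first.
    by rewrite size_map_poly; exact: size_poly.
  apply: eq_bigr => i _; rewrite coef_map coef_poly ltn_ord /=.
  case: insubP => [i' _ /val_inj->//|]; by rewrite ltn_ord.
have evinj : injective ev.
  move=> c c' E; apply/ffunP=> i.
  pose D := c - c'.
  have D0 : ev D = 0.
    rewrite /ev -[RHS](subrr (ev c)) {2}E /ev -sumrB.
    by apply: eq_bigr => l _; rewrite !ffunE rmorphB mulrBl.
  move: D0; rewrite evP; set p := \poly_(_ < _) _ => /eqP; rewrite -rootE mP.
  move=> mp; have p0 : p = 0.
    apply: contraTeq mp => pn0; apply/negP => /(dvdp_leq pn0).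
    by rewrite leqNgt sm -[X in (_ < X)%N]prednK // ltnS size_poly.
  have := coef_poly n.-1 (fun i => if insub i is Some i' then D i' else 0) i.
  rewrite -/p p0 coef0 ltn_ord; case: insubP => [i' _ /val_inj->|]; last by rewrite ltn_ord.
  by rewrite /D !ffunE => /esym/eqP; rewrite subr_eq0 => /eqP.
have evsurj y : exists c, ev c = y.
  have [h sh ->] := surj y; exists [ffun i : 'I_n.-1 => h`_i].
  rewrite /ev (@horner_coef_wide _ n.-1) ?size_map_poly //.
  by apply: eq_bigr => i _; rewrite ffunE coef_map.
have : #|K| = #|{ffun 'I_n.-1 -> k}|.
  rewrite -(card_codom evinj); apply: eq_card => y.
  by have [c <-] := evsurj y; rewrite codom_f.
by rewrite card_ffun card_ord cardK => /(expnI (finNzRing_gt1 k)).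
Qed.

(** All roots of an irreducible polynomial satisfy the same equations: if h and m
have a common root, their greatest common divisor is not constant, so it is m. *)
Lemma conjugate_root_annihilator (k K L : fieldType) (j : {rmorphism k -> K})
    (e : {rmorphism k -> L}) (m : {poly k}) (z : K) (a : L) :
  (forall h, root (map_poly j h) z = (m %| h)) -> m != 0 ->
  root (map_poly e m) a -> forall h, root (map_poly e h) a = (m %| h).
Proof.
move=> mP m0 rm h; apply/idP/idP=> [rh | /dvdpP[g ->]]; last first.
  by rewrite rmorphM /= rootM rm orbT.
have rg : root (map_poly e (gcdp m h)) a by rewrite gcdp_map root_gcd rm.
have [_ irr] := annihilator_irreducible mP m0.
have g0 : gcdp m h != 0 by rewrite gcdp_eq0 negb_and m0.
have sg : (1 < size (gcdp m h))%N.
  by rewrite -(size_map_poly e) (root_size_gt1 _ rg) // map_poly_eq0.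
have := irr _ (negbT (gtn_eqF sg)) (dvdp_gcdl m h).
by rewrite /eqp => /andP[_ /dvdp_trans]; apply; exact: dvdp_gcdr.
Qed.

Lemma expf_card_exp (L : finFieldType) (n : nat) (x : L) : x ^+ (#|L| ^ n) = x.
Proof. by elim: n => [|n IH]; rewrite ?expr1 // expnS exprM expf_card IH. Qed.

(** The q-power map is additive and fixes the coefficients. *)
Lemma frobenius_horner (k : finFieldType) (M : fieldType)
    (i : {rmorphism k -> M}) (h : {poly k}) (x : M) n :
  (map_poly i h).[x] ^+ (#|k| ^ n) = (map_poly i h).[x ^+ (#|k| ^ n)].
Proof.
have [p pp pk] := finPcharP k.
have pM : p \in [pchar M] by rewrite (fmorph_pchar i).
have card_pnat : [pchar M].-nat (#|k| ^ n)%N.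
  rewrite (eq_pnat _ (pcharf_eq pM)) pnatX.
  by have /abelem_pgroup := fin_ring_pchar_abelem pk; rewrite /pgroup cardsT => ->.
elim/poly_ind: h => [|h c IH].
  rewrite map_poly0 !horner0 expr0n eqn0Ngt expn_gt0.
  by rewrite (ltn_trans _ (finNzRing_gt1 k)).
rewrite rmorphD rmorphM /= map_polyX map_polyC !hornerE.
by rewrite exprDn_pchar // exprMn IH -rmorphXn /= expf_card_exp.
Qed.

(** Packs a function known only inside a proof into a morphism. *)
Lemma rmorphism_of_fun (A B : nzRingType) (f : A -> B) :
  zmod_morphism f -> monoid_morphism f -> exists g : {rmorphism A -> B}, g =1 f.
Proof.
move=> fB fM.
pose fB' := GRing.isZmodMorphism.Build A B f fB.
pose fM' := GRing.isMonoidMorphism.Build A B f fM.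
by exists (HB.pack f fB' fM' : {rmorphism A -> B}).
Qed.

Section ConjugateRoots.
Variables (k K L : finFieldType) (j : {rmorphism k -> K}) (e : {rmorphism k -> L}).
Variables (d r : nat) (m : {poly k}) (z : K).
Hypothesis cardK : #|K| = (#|k| ^ d)%N.
Hypothesis cardL : #|L| = (#|k| ^ r)%N.
Hypothesis d_gt0 : (0 < d)%N.
Hypothesis m_monic : m \is monic.
Hypothesis size_m : size m = d.+1.
Hypothesis mP : forall h, root (map_poly j h) z = (m %| h).
Hypothesis genP : forall y, exists2 h : {poly k}, (size h <= d)%N
  & y = (map_poly j h).[z].

Let m0 : m != 0. Proof. exact: monic_neq0. Qed.

(** If z is fixed by the q^n-power map, then K = k[z] is fixed by the q^s-power
map, s being n modulo d. For s > 0 the polynomial X^(q^s) - X would have q^d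
roots, more than its degree. *)
Lemma pow_card_generator n : (z ^+ (#|k| ^ n) == z) = (d %| n)%N.
Proof.
apply/eqP/idP => [zn | /dvdnP[s ->]]; last first.
  by rewrite mulnC expnM -cardK expf_card_exp.
have zs : z ^+ (#|k| ^ (n %% d)) = z.
  rewrite -[RHS]zn {2}(divn_eq n d) expnD exprM; congr (_ ^+ _).
  by rewrite mulnC expnM -cardK expf_card_exp.
have ys (y : K) : y ^+ (#|k| ^ (n %% d)) = y.
  by have [h _ ->] := genP y; rewrite frobenius_horner zs.
rewrite /dvdn; case Es : (n %% d)%N => [//|s].
have q1 : (1 < #|k|)%N := finNzRing_gt1 k.
pose p : {poly K} := 'X^(#|k| ^ s.+1) - 'X.
have sp : size p = (#|k| ^ s.+1).+1.
  rewrite size_polyDl size_polyXn // size_polyN size_polyX ltnS.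
  by rewrite -[X in (X < _)%N](expn0 #|k|) ltn_exp2l.
have p0 : p != 0 by rewrite -size_poly_eq0 sp.
have := @max_poly_roots _ p (enum K) p0.
have -> : all (root p) (enum K).
  by apply/allP=> y _; rewrite rootE !hornerE -Es ys subrr.
rewrite enum_uniq -cardE cardK sp ltnS leq_exp2l // leqNgt -Es.
by rewrite ltn_mod d_gt0; move/(_ isT isT).
Qed.

Let Xq n : {poly k} := 'X^(#|k| ^ n) - 'X.

Lemma dvdp_generator n : (m %| Xq n) = (d %| n)%N.
Proof.
rewrite -mP rmorphB /= map_polyXn map_polyX rootE !hornerE.
by rewrite subr_eq0 pow_card_generator.
Qed.

Lemma map_Xq : map_poly e (Xq r) = \prod_x ('X - x%:P).
Proof. by rewrite rmorphB /= map_polyXn map_polyX -cardL finField_genPoly. Qed.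

(** Elements of L satisfy the equation x^(q^r) = x, hence so does the conjugate z
of a root in L. *)
Lemma root_generator_dvd a : root (map_poly e m) a -> (d %| r)%N.
Proof.
move=> ra; rewrite -dvdp_generator -(conjugate_root_annihilator mP m0 ra).
by rewrite rootE rmorphB /= map_polyXn map_polyX !hornerE -cardL expf_card subrr.
Qed.

(** If d | r then m divides X^(q^r) - X, which splits in L into distinct linear
factors. *)
Lemma card_conjugate_roots :
  #|[set a | root (map_poly e m) a]%SET| = (if (d %| r)%N then d else 0)%N.
Proof.
case: ifPn => dr; last first.
  apply/eqP; rewrite cards_eq0; apply/eqP/setP=> a; rewrite !inE.
  by apply: contraNF dr; exact: root_generator_dvd.
have : map_poly e m %| \prod_(x <- enum L) ('X - x%:P).
  by rewrite big_enum /= -map_Xq dvdp_map dvdp_generator.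
case/dvdp_prod_XsubC=> b eqm.
have ub : uniq (mask b (enum L)) by rewrite mask_uniq ?enum_uniq.
rewrite -[RHS]/(d.+1.-1) -size_m -(size_map_poly e) (eqp_size eqm).
rewrite size_prod_XsubC /= -(card_uniqP ub).
by apply: eq_card => a; rewrite inE (eqp_root eqm) root_prod_XsubC.
Qed.

(** Separability of m, again because it divides the separable polynomial
X^(q^r) - X. *)
Lemma conjugate_root_simple a : root (map_poly e m) a ->
  exists2 g : {poly L}, map_poly e m = g * ('X - a%:P) & g.[a] != 0.
Proof.
move=> ra; have dr := root_generator_dvd ra.
have /factor_theorem[g Dg] := ra; exists g => //.
have : map_poly e m %| map_poly e (Xq r) by rewrite dvdp_map dvdp_generator.
case/dvdpP=> u; rewrite map_Xq Dg (bigD1 a) //= mulrA [RHS]mulrC.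
move/(mulfI (monic_neq0 (monicXsubC a))) => E.
have : (\prod_(i | i != a) ('X - i%:P)).[a] != 0.
  rewrite horner_prod; apply/prodf_neq0 => x xa.
  by rewrite !hornerE subr_eq0 eq_sym.
by rewrite E hornerM mulf_eq0 negb_or => /andP[].
Qed.

(** The map sending h(z) to h(a) is well defined because z and a have the same
annihilator. *)
Lemma conjugate_embedding a : root (map_poly e m) a ->
  exists2 psi : {rmorphism K -> L}, psi z = a & forall c, psi (j c) = e c.
Proof.
move=> ra; have raP := conjugate_root_annihilator mP m0 ra.
have gen1 y : exists h : {poly k}, y = (map_poly j h).[z].
  by have [h _ ->] := genP y; exists h.
have [lift liftP] := choice gen1.
pose f y := (map_poly e (lift y)).[a].
have fE h y : y = (map_poly j h).[z] -> f y = (map_poly e h).[a].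
  rewrite {1}(liftP y) => /eqP; rewrite -subr_eq0 -hornerN -hornerD -rmorphN -rmorphD /=.
  rewrite -rootE mP -raP rootE rmorphB hornerD hornerN subr_eq0.
  by move/eqP.
have fj c : f (j c) = e c.
  by rewrite (fE c%:P) map_polyC !hornerC.
have [||psi psiE] := @rmorphism_of_fun K L f.
- move=> x y; rewrite (fE (lift x - lift y)) ?rmorphB ?hornerD ?hornerN //.
  by rewrite -!liftP.
- split; first by rewrite -(rmorph1 j) fj rmorph1.
  move=> x y; rewrite (fE (lift x * lift y)) ?rmorphM ?hornerM //.
  by rewrite -!liftP.
exists psi => [|c]; rewrite psiE ?fj //.
by rewrite (fE 'X) map_polyX hornerX.
Qed.

End ConjugateRoots.

(** * Valuation rings of places *)

Section PlaceTheory.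
Variables (k F : fieldType) (iota : {rmorphism k -> F}).
Implicit Types (P : place iota) (x y : F).

Lemma place_eq P Q : place_ring P = place_ring Q -> P = Q.
Proof.
case: P Q => [O hO] [O' hO'] /= E; case: O' / E hO' => hO'.
by congr Place; exact: Prop_irrelevance.
Qed.

Section OnePlace.
Variable P : place iota.
Local Notation O := (place_ring P).
Local Notation M := (place_ideal P).

Lemma place_ring_const c : O (iota c).
Proof. by have [] := place_ringP P. Qed.

Lemma place_ringB x y : O x -> O y -> O (x - y).
Proof. by have [_ + _ _ _] := place_ringP P; apply. Qed.

Lemma place_ringM x y : O x -> O y -> O (x * y).
Proof. by have [_ _ + _ _] := place_ringP P; apply. Qed.

Lemma place_ring0 : O 0.
Proof. by rewrite -(rmorph0 iota); exact: place_ring_const. Qed.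

Lemma place_ring1 : O 1.
Proof. by rewrite -(rmorph1 iota); exact: place_ring_const. Qed.

Definition place_ring_pred : {pred F} := fun x => `[< O x >].

Lemma place_ring_predP x : reflect (O x) (x \in place_ring_pred).
Proof. exact: asboolP. Qed.

Fact place_ring_pred_subring : subring_closed place_ring_pred.
Proof.
split=> [|x y|x y]; first by apply/place_ring_predP; exact: place_ring1.
  by move=> /place_ring_predP ? /place_ring_predP ?; apply/place_ring_predP/place_ringB.
by move=> /place_ring_predP ? /place_ring_predP ?; apply/place_ring_predP/place_ringM.
Qed.

HB.instance Definition _ :=
  GRing.isSubringClosed.Build F place_ring_pred place_ring_pred_subring.

(** The valuation ring as a type, so that it can carry ring morphisms and be a
coefficient ring for polynomials. *)
Record vring := Vring { vring_val : F; _ : vring_val \in place_ring_pred }.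
HB.instance Definition _ := [isSub for vring_val].
HB.instance Definition _ := [Choice of vring by <:].
HB.instance Definition _ := [SubChoice_isSubComNzRing of vring by <:].

Lemma vringP (x : vring) : O (val x).
Proof. exact/place_ring_predP/valP. Qed.

Lemma vring_lift x : O x -> exists y : vring, val y = x.
Proof. by move=> /place_ring_predP Ox; exists (Sub x Ox); rewrite SubK. Qed.

Lemma vring_val_eq0 (x : vring) : (val x == 0) = (x == 0).
Proof. by rewrite -(rmorph0 (val : vring -> F)) val_eqE. Qed.

Lemma place_ringD x y : O x -> O y -> O (x + y).
Proof. by move=> /vring_lift[a <-] /vring_lift[b <-]; rewrite -rmorphD; exact: vringP. Qed.

Lemma place_ringN x : O x -> O (- x).
Proof. by move=> /vring_lift[a <-]; rewrite -rmorphN; exact: vringP. Qed.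

Lemma place_ringX x n : O x -> O (x ^+ n).
Proof. by move=> /vring_lift[a <-]; rewrite -rmorphXn; exact: vringP. Qed.

Lemma place_ring_sum (I : Type) (s : seq I) (p : pred I) (f : I -> F) :
  (forall i, p i -> O (f i)) -> O (\sum_(i <- s | p i) f i).
Proof. by apply: big_ind; [exact: place_ring0 | exact: place_ringD]. Qed.

Lemma place_ideal_ring x : M x -> O x. Proof. by case. Qed.

Lemma place_ringV x : x != 0 -> O x \/ O x^-1.
Proof. by have [_ _ _ _ +] := place_ringP P; apply. Qed.

Lemma place_ring_total x y : (exists2 a, O a & x = a * y) \/ (exists2 a, O a & y = a * x).
Proof.
have [->|x0] := eqVneq x 0; first by left; exists 0; rewrite ?mul0r //; exact: place_ring0.
have [->|y0] := eqVneq y 0; first by right; exists 0; rewrite ?mul0r //; exact: place_ring0.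
have /place_ringV[H|H] : x / y != 0 by rewrite mulf_neq0 ?invr_eq0.
  by left; exists (x / y) => //; rewrite divfK.
by right; exists (x / y)^-1 => //; rewrite invfM invrK mulrAC mulVf ?mul1r.
Qed.

Lemma place_idealV x : ~ O x -> M x^-1.
Proof.
move=> Ox; have x0 : x != 0.
  by apply/eqP=> x0; apply: Ox; rewrite x0; exact: place_ring0.
split; last by right; rewrite invrK.
by have [|] := place_ringV x0.
Qed.

Lemma place_unit x : O x -> ~ M x -> x != 0 /\ O x^-1.
Proof.
move=> Ox Mx; split.
  by apply/eqP=> x0; apply: Mx; split=> //; left.
by apply: contrapT => Ox'; apply: Mx; split=> //; right.
Qed.

Lemma place_ideal1 : ~ M 1.
Proof.
by case=> _ [/eqP|]; rewrite ?oner_eq0 // invr1 => /(_ place_ring1).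
Qed.

Lemma place_ideal0 : M 0.
Proof. by split; [exact: place_ring0 | left]. Qed.

Lemma place_idealMl a x : O a -> M x -> M (a * x).
Proof.
move=> Oa [Ox Mx]; split; first exact: place_ringM.
have [->|ax0] := eqVneq (a * x) 0; [by left | right=> H].
have [a0 x0] : a != 0 /\ x != 0 by apply/andP; rewrite -negb_or -mulf_eq0.
case: Mx => [/eqP|]; first by rewrite (negbTE x0).
by apply; rewrite -[x^-1](mulVKf a0) -invfM; exact: place_ringM.
Qed.

Lemma place_idealD x y : M x -> M y -> M (x + y).
Proof.
move=> Mx My; have [[a Oa ->]|[a Oa ->]] := place_ring_total x y.
  rewrite -[X in _ + X]mul1r -mulrDl.
  by apply: place_idealMl => //; apply: place_ringD => //; exact: place_ring1.
rewrite -[X in X + _]mul1r -mulrDl.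
by apply: place_idealMl => //; apply: place_ringD => //; exact: place_ring1.
Qed.

Lemma place_idealN x : M x -> M (- x).
Proof. by rewrite -mulN1r; apply: place_idealMl; apply: place_ringN; exact: place_ring1. Qed.

Lemma place_idealB x y : M x -> M y -> M (x - y).
Proof. by move=> Mx /place_idealN; exact: place_idealD. Qed.

Lemma place_ideal_const c : M (iota c) -> c = 0.
Proof.
move=> Mc; apply/eqP; apply: contra_notT place_ideal1 => c0.
rewrite -(rmorph1 iota) -(mulVf c0) rmorphM.
by apply: place_idealMl => //; exact: place_ring_const.
Qed.

Lemma vring_const_ex c : exists x : vring, val x = iota c.
Proof. by apply: vring_lift; exact: place_ring_const. Qed.

Definition vring_const c : vring := projT1 (cid (vring_const_ex c)).

Lemma vring_constE c : val (vring_const c) = iota c.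
Proof. exact: projT2 (cid (vring_const_ex c)). Qed.

Fact vring_const_zmod : zmod_morphism vring_const.
Proof. by move=> c c'; apply: val_inj; rewrite rmorphB /= !vring_constE rmorphB. Qed.

Fact vring_const_monoid : monoid_morphism vring_const.
Proof.
by split=> [|c c']; apply: val_inj; rewrite ?rmorphM ?rmorph1 /= !vring_constE ?rmorphM ?rmorph1.
Qed.

HB.instance Definition _ := GRing.isZmodMorphism.Build k vring vring_const vring_const_zmod.
HB.instance Definition _ := GRing.isMonoidMorphism.Build k vring vring_const vring_const_monoid.

Lemma vring_horner_const (h : {poly k}) (x : vring) :
  val (map_poly vring_const h).[x] = (map_poly iota h).[val x].
Proof. by rewrite -(eq_map_poly vring_constE) (map_poly_comp val) horner_map. Qed.

End OnePlace.
End PlaceTheory.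

(** * Residue fields and degrees *)

Section QuotientDim.
Variables (k : finFieldType) (F : fieldType) (iota : {rmorphism k -> F}).

(** Sending coordinates along v' to coordinates along v is injective, since both
determine the class modulo W; the comparison of cardinals uses that k is
finite. *)
Lemma quotient_dim_le (V W : set F) n (v : 'I_n -> F) n' (v' : 'I_n' -> F) :
  (forall c : {ffun 'I_n' -> k}, V (\sum_i iota (c i) * v' i)) ->
  W 0 -> (forall x y, W x -> W y -> W (x - y)) ->
  is_quotient_basis iota V W v -> is_quotient_basis iota V W v' -> (n' <= n)%N.
Proof.
move=> Vc W0 WB [_ hv] [_ hv'].
have /choice[f fP] : forall c : {ffun 'I_n' -> k}, exists b : {ffun 'I_n -> k},
    W (\sum_i iota (c i) * v' i - \sum_i iota (b i) * v i).
  by move=> c; have [b [Wb _]] := hv _ (Vc c); exists b.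
have finj : injective f.
  move=> c c' E; have [b [_ bu]] := hv' _ (Vc c).
  have := WB _ _ (fP c) (fP c'); rewrite E opprB addrA subrK => Wcc'.
  by rewrite -(bu c') // (bu c) // subrr.
have : (#|{ffun 'I_n' -> k}| <= #|{ffun 'I_n -> k}|)%N by exact: leq_card finj.
by rewrite !card_ffun !card_ord leq_exp2l //; exact: finNzRing_gt1.
Qed.

Lemma quotient_dimE (V W : set F) n (v : 'I_n -> F) :
  (forall x y, V x -> V y -> V (x + y)) -> (forall c x, V x -> V (iota c * x)) -> V 0 ->
  W 0 -> (forall x y, W x -> W y -> W (x - y)) ->
  is_quotient_basis iota V W v -> quotient_dim iota V W = n.
Proof.
move=> VD VZ V0 W0 WB hv.
have Vc n' (v' : 'I_n' -> F) : is_quotient_basis iota V W v' ->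
    forall c : {ffun 'I_n' -> k}, V (\sum_i iota (c i) * v' i).
  by case=> Vv' _ c; apply: big_ind => // i _; exact: VZ.
rewrite /quotient_dim; case: xgetP => [n' _ [v' hv']|/(_ n)[]]; last by exists v.
apply/eqP; rewrite eqn_leq.
rewrite (quotient_dim_le (Vc _ _ hv') W0 WB hv hv').
by rewrite (quotient_dim_le (Vc _ _ hv) W0 WB hv' hv).
Qed.

End QuotientDim.

Section Residue.
Variables (k : finFieldType) (F : fieldType) (iota : {rmorphism k -> F}).
Variables (P : place iota) (d : nat) (v : 'I_d -> F).
Hypothesis hv : is_quotient_basis iota (place_ring P) (place_ideal P) v.

(** The residue field of P, carried by coordinate vectors along a basis of O_P
modulo its ideal, which makes it a finite type of known cardinal. The dummy
argument attaches the basis to the type, for the field structure to depend on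
it. *)
Definition residue & is_quotient_basis iota (place_ring P) (place_ideal P) v :=
  {ffun 'I_d -> k}.
Local Notation kappa := (residue hv).
HB.instance Definition _ := Finite.on kappa.
HB.instance Definition _ := GRing.Zmodule.on kappa.

Lemma residue_lift_ex (a : kappa) : exists x : vring P, val x = \sum_i iota (a i) * v i.
Proof.
apply: vring_lift; apply: place_ring_sum => i _; apply: place_ringM.
  exact: place_ring_const.
by have [] := hv.
Qed.

Definition residue_lift (a : kappa) : vring P := projT1 (cid (residue_lift_ex a)).

Lemma residue_liftE a : val (residue_lift a) = \sum_i iota (a i) * v i.
Proof. exact: projT2 (cid (residue_lift_ex a)). Qed.

Lemma residue_ex (x : vring P) : exists a : kappa,
  place_ideal P (val (x - residue_lift a)).
Proof.
have [_ /(_ (val x) (vringP x))[a [Ma _]]] := hv.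
by exists a; rewrite rmorphB /= residue_liftE.
Qed.

Definition residue_map x : kappa := projT1 (cid (residue_ex x)).

Lemma residue_mapP x : place_ideal P (val (x - residue_lift (residue_map x))).
Proof. exact: projT2 (cid (residue_ex x)). Qed.

Lemma residue_map_eq x a : place_ideal P (val (x - residue_lift a)) -> residue_map x = a.
Proof.
have [_ /(_ (val x) (vringP x))[b [_ ub]]] := hv.
move=> Ma; have := residue_mapP x; rewrite rmorphB /= residue_liftE => /ub <-.
by move: Ma; rewrite rmorphB /= residue_liftE => /ub <-.
Qed.

Lemma residue_liftK a : residue_map (residue_lift a) = a.
Proof. by apply: residue_map_eq; rewrite subrr rmorph0; exact: place_ideal0. Qed.

Lemma residue_map_cong x y : place_ideal P (val (x - y)) -> residue_map x = residue_map y.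
Proof.
move=> Mxy; apply: residue_map_eq.
have := place_idealD Mxy (residue_mapP y).
by rewrite -rmorphD /= addrA subrK.
Qed.

Lemma residue_mapB : {morph residue_map : x y / x - y}.
Proof.
move=> x y; apply: residue_map_eq.
have -> : val (x - y - residue_lift (residue_map x - residue_map y)) =
    val (x - residue_lift (residue_map x)) - val (y - residue_lift (residue_map y)).
  rewrite !rmorphB /= !residue_liftE.
  have -> : \sum_i iota ((residue_map x - residue_map y) i) * v i =
      \sum_i iota (residue_map x i) * v i - \sum_i iota (residue_map y i) * v i.
    by rewrite -sumrB; apply: eq_bigr => i _; rewrite !ffunE rmorphB mulrBl.
  by rewrite !opprD !opprK addrACA.
by apply: place_idealB; exact: residue_mapP.
Qed.

HB.instance Definition _ :=
  GRing.isZmodMorphism.Build (vring P) kappa residue_map residue_mapB.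

Definition residue_one : kappa := residue_map 1.
Definition residue_mul (a b : kappa) : kappa :=
  residue_map (residue_lift a * residue_lift b).

Lemma residue_map_mul x y :
  residue_map (x * y) = residue_mul (residue_map x) (residue_map y).
Proof.
apply: residue_map_cong.
set a := residue_lift _; set b := residue_lift _.
have -> : x * y - a * b = y * (x - a) + a * (y - b).
  by rewrite !mulrBr (mulrC y x) (mulrC y a) addrA subrK.
rewrite rmorphD !rmorphM; apply: place_idealD.
  by apply: place_idealMl; [exact: vringP | exact: residue_mapP].
by apply: place_idealMl; [exact: vringP | exact: residue_mapP].
Qed.

Fact residue_mulA : associative residue_mul.
Proof.
move=> a b c; rewrite -(residue_liftK a) -(residue_liftK b) -(residue_liftK c).
by rewrite -!residue_map_mul mulrA.
Qed.

Fact residue_mulC : commutative residue_mul.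
Proof. by move=> a b; rewrite /residue_mul mulrC. Qed.

Fact residue_mul1 : left_id residue_one residue_mul.
Proof. by move=> a; rewrite -(residue_liftK a) -residue_map_mul mul1r. Qed.

Fact residue_mulDl : left_distributive residue_mul +%R.
Proof.
move=> a b c; rewrite -(residue_liftK a) -(residue_liftK b) -(residue_liftK c).
by rewrite -raddfD -!residue_map_mul mulrDl raddfD.
Qed.

Lemma residue_map_eq0 x : (residue_map x = 0) <-> place_ideal P (val x).
Proof.
split=> [x0|Mx].
  have := residue_mapP x; rewrite rmorphB /= residue_liftE big1 ?subr0 // => i _.
  by rewrite x0 ffunE rmorph0 mul0r.
by rewrite -(raddf0 residue_map); apply: residue_map_cong; rewrite subr0.
Qed.

Fact residue_one_neq0 : residue_one != 0.
Proof.
by apply/eqP => /residue_map_eq0; rewrite rmorph1; exact: place_ideal1.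
Qed.

HB.instance Definition _ := GRing.Zmodule_isComNzRing.Build kappa
  residue_mulA residue_mulC residue_mul1 residue_mulDl residue_one_neq0.

(** The second clause fixes the inverse of 0 as the interface of fields requires. *)
Lemma residue_inv_ex (a : kappa) :
  exists b : kappa, (a != 0 -> b * a = 1) /\ (a = 0 -> b = 0).
Proof.
have [->|a0] := eqVneq a 0; first by exists 0; split.
have Ma : ~ place_ideal P (val (residue_lift a)).
  by move/residue_map_eq0; rewrite residue_liftK => /eqP; rewrite (negbTE a0).
have [a0' /vring_lift[b Db]] := place_unit (vringP _) Ma.
exists (residue_map b); split=> [_|/eqP]; last by rewrite (negbTE a0).
rewrite -{1}(residue_liftK a) -[LHS]residue_map_mul.
by congr residue_map; apply: val_inj; rewrite rmorphM rmorph1 /= Db mulVf.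
Qed.

Definition residue_inv a := projT1 (cid (residue_inv_ex a)).

Fact residue_mulVf a : a != 0 -> residue_inv a * a = 1.
Proof. by have [+ _] := projT2 (cid (residue_inv_ex a)); apply. Qed.

Fact residue_inv0 : residue_inv 0 = 0.
Proof. by have [_] := projT2 (cid (residue_inv_ex 0)); apply. Qed.

HB.instance Definition _ := GRing.ComNzRing_isField.Build kappa residue_mulVf residue_inv0.

Fact residue_map_monoid : monoid_morphism residue_map.
Proof. by split=> // x y; exact: residue_map_mul. Qed.

HB.instance Definition _ :=
  GRing.isMonoidMorphism.Build (vring P) kappa residue_map residue_map_monoid.

Lemma residue_field_of_basis : exists (K : finFieldType) (rho : {rmorphism vring P -> K}),
  [/\ forall y, exists x, rho x = y,
      forall x, rho x = 0 <-> place_ideal P (val x) &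
      #|K| = (#|k| ^ d)%N].
Proof.
exists (residue hv : finFieldType), residue_map; split.
- by move=> y; exists (residue_lift y); exact: residue_liftK.
- exact: residue_map_eq0.
- by rewrite card_ffun card_ord.
Qed.

End Residue.

Section ResidueField.
Variables (k : finFieldType) (F : fieldType) (iota : {rmorphism k -> F}).
Variable (P : place iota).

(** The degree is positive only if a basis exists, since it defaults to 0. *)
Lemma residue_field : (0 < place_degree P)%N ->
  exists (K : finFieldType) (rho : {rmorphism vring P -> K}),
  [/\ forall y, exists x, rho x = y,
      forall x, rho x = 0 <-> place_ideal P (val x) &
      #|K| = (#|k| ^ place_degree P)%N].
Proof.
rewrite /place_degree /quotient_dim; case: xgetP => // d _ [v hv] _.
exact: residue_field_of_basis hv.
Qed.

End ResidueField.

(** * Residues in the constant field *)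

Section Congruence.
Variables (k F : fieldType) (iota : {rmorphism k -> F}) (P : place iota).
Implicit Types (x y : F) (c : k).

Definition has_residue x c := place_ideal P (x - iota c).

Lemma has_residue_ring x c : has_residue x c -> place_ring P x.
Proof.
move=> /place_ideal_ring Ox; rewrite -(subrK (iota c) x).
by apply: place_ringD => //; exact: place_ring_const.
Qed.

Lemma has_residue_const c : has_residue (iota c) c.
Proof. by rewrite /has_residue subrr; exact: place_ideal0. Qed.

Lemma has_residueD x y c c' : has_residue x c -> has_residue y c' -> has_residue (x + y) (c + c').
Proof. by rewrite /has_residue rmorphD opprD addrACA; exact: place_idealD. Qed.

Lemma has_residueM x y c c' : has_residue x c -> has_residue y c' -> has_residue (x * y) (c * c').
Proof.
move=> xc yc'; rewrite /has_residue rmorphM.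
have -> : x * y - iota c * iota c' = y * (x - iota c) + iota c * (y - iota c').
  by rewrite !mulrBr (mulrC y x) (mulrC y) addrA subrK.
apply: place_idealD; apply: place_idealMl => //; first exact: has_residue_ring yc'.
exact: place_ring_const.
Qed.

Lemma has_residue_uniq x c c' : has_residue x c -> has_residue x c' -> c = c'.
Proof.
move=> xc xc'; apply/eqP; rewrite -subr_eq0; apply/eqP.
apply: (@place_ideal_const _ _ _ P); rewrite rmorphB.
have := place_idealB xc' xc; by rewrite opprB addrC addrA subrK.
Qed.

Lemma has_residue0 x : has_residue x 0 <-> place_ideal P x.
Proof. by rewrite /has_residue rmorph0 subr0. Qed.

Lemma has_residue_horner (h : {poly k}) x c : has_residue x c ->
  has_residue (map_poly iota h).[x] h.[c].
Proof.
move=> xc; elim/poly_ind: h => [|h a IH].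
  by rewrite map_poly0 !horner0; apply/has_residue0; exact: place_ideal0.
rewrite rmorphD rmorphM /= map_polyX map_polyC !hornerE.
by apply: has_residueD; [exact: has_residueM | exact: has_residue_const].
Qed.

Lemma has_residue_unit x c : has_residue x c -> c != 0 -> x != 0 /\ place_ring P x^-1.
Proof.
move=> xc c0; apply: place_unit; first exact: has_residue_ring xc.
by move/has_residue0 => x0; move: c0; rewrite (has_residue_uniq xc x0) eqxx.
Qed.

End Congruence.

(** Valuation rings are maximal for domination: an element x of O_Q outside O_P
would have its inverse in the ideal of P, hence in that of Q. *)
Lemma place_dominate (k F : fieldType) (iota : {rmorphism k -> F}) (P Q : place iota) :
  (forall x, place_ring P x -> place_ring Q x) ->
  (forall x, place_ideal P x -> place_ideal Q x) -> P = Q.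
Proof.
move=> OPQ MPQ; apply: place_eq; apply/seteqP; split=> // x Qx.
apply: contrapT => Px; have /MPQ Mx := place_idealV Px.
have x0 : x != 0 by apply/eqP => x0; apply: Px; rewrite x0; exact: place_ring0.
by apply: (@place_ideal1 _ _ _ Q); rewrite -(mulfV x0); exact: place_idealMl.
Qed.

Section DegreeOne.
Variables (k : finFieldType) (F : fieldType) (iota : {rmorphism k -> F}) (P : place iota).

(** In degree one the residue field is k, so residues can be taken in k itself
instead of along a basis. *)
Lemma place_degree1P : place_degree P = 1%N <->
  forall x, place_ring P x -> exists c, has_residue P x c.
Proof.
split=> [|H].
  rewrite /place_degree /quotient_dim; case: xgetP => // d _ [v [Ov hv]] d1.
  rewrite d1 in v Ov hv => {d d1}.
  have vE x : place_ring P x -> exists c, place_ideal P (x - iota c * v ord0).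
    by move=> /hv[c [Mc _]]; exists (c ord0); rewrite big_ord1 in Mc.
  have [c0 M0] := vE _ (place_ring1 P).
  have c00 : c0 != 0.
    apply/eqP => c00; apply: (@place_ideal1 _ _ _ P).
    by move: M0; rewrite c00 rmorph0 mul0r subr0.
  move=> x /vE[c Mx]; exists (c / c0); rewrite /has_residue.
  have -> : x - iota (c / c0) = x - iota c * v ord0 - iota (c / c0) * (1 - iota c0 * v ord0).
    rewrite mulrBr mulr1 mulrA -rmorphM divfK // opprB addrA addrAC.
    by rewrite addrAC subrK.
  by apply: place_idealB => //; apply: place_idealMl => //; exact: place_ring_const.
apply: (@quotient_dimE _ _ _ _ _ _ (fun _ : 'I_1 => 1)).
- by move=> x y; exact: place_ringD.
- by move=> c x; apply: place_ringM; exact: place_ring_const.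
- exact: place_ring0.
- exact: place_ideal0.
- by move=> x y; exact: place_idealB.
split=> [_|x Ox]; first exact: place_ring1.
have [c xc] := H x Ox; exists [ffun=> c]; split.
  by rewrite big_ord1 ffunE mulr1.
move=> c'; rewrite big_ord1 mulr1 => xc'; apply/ffunP => i; rewrite ffunE ord1.
exact: has_residue_uniq xc xc'.
Qed.

End DegreeOne.

(** * The archimedean property *)

Section Dependence.
Variables (k : finFieldType) (F : fieldType) (iota : {rmorphism k -> F}).
Variables (x0 : F) (n : nat) (v : 'I_n -> F).
Local Notation ev p := (map_poly iota p).[x0].

Lemma common_denominator (I : finType) (c : I -> F) :
  (forall i, rational_subfield iota x0 (c i)) ->
  exists2 D : {poly k}, ev D != 0 &
    exists p : I -> {poly k}, forall i, ev D * c i = ev (p i).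
Proof.
move=> hc.
have /choice[pr prP] i : exists pr : {poly k} * {poly k}, ev pr.2 != 0 /\ c i = ev pr.1 / ev pr.2.
  by have [p [r [r0 ->]]] := hc i; exists (p, r).
exists (\prod_i (pr i).2).
  rewrite rmorph_prod horner_prod; apply/prodf_neq0 => i _.
  by have [] := prP i.
exists (fun i => (pr i).1 * \prod_(l | l != i) (pr l).2) => i.
have [r0 ->] := prP i.
rewrite (bigD1 i) //= !rmorphM /= !hornerM.
by rewrite mulrC mulrA divfK.
Qed.

(** Polynomials in y and z with bounded degrees stay, after multiplication by a
fixed denominator, in such a space of dimension linear in the bound. *)
Definition bounded_span (l : nat) (w : F) :=
  exists2 p : 'I_n -> {poly k}, (forall i, size (p i) <= l.+1)%N
    & w = \sum_i ev (p i) * v i.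

Lemma bounded_spanD l w w' :
  bounded_span l w -> bounded_span l w' -> bounded_span l (w + w').
Proof.
move=> [p sp ->] [p' sp' ->]; exists (fun i => p i + p' i).
  by move=> i; rewrite (leq_trans (size_polyD _ _)) // geq_max sp sp'.
by rewrite -big_split; apply: eq_bigr => i _; rewrite rmorphD hornerD mulrDl.
Qed.

Lemma bounded_spanZ l c w : bounded_span l w -> bounded_span l (iota c * w).
Proof.
move=> [p sp ->]; exists (fun i => c *: p i).
  by move=> i; rewrite (leq_trans (size_scale_leq _ _)).
by rewrite mulr_sumr; apply: eq_bigr => i _; rewrite map_polyZ hornerZ mulrA.
Qed.

Lemma bounded_span0 l : bounded_span l 0.
Proof.
exists (fun=> 0); first by move=> i; rewrite size_poly0.
by rewrite big1 // => i _; rewrite map_poly0 horner0 mul0r.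
Qed.

Lemma bounded_span_mul l e u w (Y : 'I_n -> 'I_n -> {poly k}) :
  (forall i, u * v i = \sum_h ev (Y i h) * v h) ->
  (forall i h, size (Y i h) <= e.+1)%N ->
  bounded_span l w -> bounded_span (l + e) (u * w).
Proof.
move=> uv sY [p sp ->]; exists (fun h => \sum_i p i * Y i h).
  move=> h; apply: (leq_trans (size_sum _ _ _)); apply/bigmax_leqP => i _.
  apply: (leq_trans (size_polyMleq _ _)).
  by have := sp i; have := sY i h; lia.
rewrite mulr_sumr.
under eq_bigr => i _ do rewrite mulrCA uv mulr_sumr.
rewrite exchange_big; apply: eq_bigr => h _.
rewrite rmorph_sum /= horner_sum mulr_suml; apply: eq_bigr => i _.
by rewrite rmorphM hornerM mulrA.
Qed.

Definition span_of_coefs l (b : {ffun 'I_n * 'I_l.+1 -> k}) : F :=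
  \sum_i ev (\poly_(h < l.+1) b (i, inord h)) * v i.

Lemma bounded_span_coefs l w : bounded_span l w -> exists b, w = @span_of_coefs l b.
Proof.
move=> [p sp ->]; exists [ffun ih : 'I_n * 'I_l.+1 => (p ih.1)`_ih.2].
apply: eq_bigr => i _; congr (_.[_] * _); congr map_poly.
apply/polyP => h; rewrite coef_poly; case: ltnP => hl; first by rewrite ffunE /= inordK.
by rewrite nth_default // (leq_trans (sp i)).
Qed.

Hypothesis spanP : forall y, exists c : 'I_n -> F,
  (forall i, rational_subfield iota x0 (c i)) /\ y = \sum_i c i * v i.

(** There are M^2 monomials y^i z^j with i, j < M, and up to a common denominator
their combinations lie in a space whose dimension over k grows linearly with M.
For large M the pigeonhole principle provides two combinations with the same
value. *)
Lemma algebraic_dependence (y z : F) : exists M,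
  exists2 c : {ffun 'I_M * 'I_M -> k}, c != 0 & \sum_i iota (c i) * (y ^+ i.1 * z ^+ i.2) = 0.
Proof.
(* u enumerates 1, y and z, so that one denominator D serves all three; powers
   of D * 1 pad the monomials to the same power of D. *)
pose u (t : 'I_3) := nth z [:: 1; y] t.
have [c0 [rc0 one]] := spanP 1.
have /choice[c cP] (ti : 'I_3 * 'I_n) := spanP (u ti.1 * v ti.2).
have [D D0 [Y DY]] := @common_denominator _ (fun j : 'I_3 * 'I_n * 'I_n => c j.1 j.2)
  (fun j => (cP j.1).1 j.2).
have [D1 D10 [Y1 DY1]] := common_denominator rc0.
pose e := \max_j size (Y j); pose e0 := \max_j size (Y1 j).
have mulu t l s : bounded_span l s -> bounded_span (l + e) (ev D * u t * s).
  apply: (@bounded_span_mul _ _ _ _ (fun i h => Y (t, i, h))).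
    move=> i; rewrite -mulrA (cP (t, i)).2 mulr_sumr; apply: eq_bigr => h _.
    by rewrite mulrA; have /= -> := DY (t, i, h).
  by move=> i h; apply: leqW; exact: (leq_bigmax (F := fun j => size (Y j))).
have muluX t a l s : bounded_span l s -> bounded_span (l + a * e) ((ev D * u t) ^+ a * s).
  move=> ls; elim: a => [|a IH]; first by rewrite mul1r addn0.
  by rewrite exprS -mulrA mulSn addnCA addnC; exact: mulu.
have base : bounded_span e0 (ev D1).
  exists Y1; first by move=> i; apply: leqW; exact: (leq_bigmax (F := fun j => size (Y1 j))).
  by rewrite -[LHS]mulr1 one mulr_sumr; apply: eq_bigr => i _; rewrite mulrA DY1.
(* M is chosen so that n * (e0 + 2 * M * e + 1) < M * M. *)
pose M := (n * (e0.+1 + 2 * e)).+1.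
pose l := (e0 + 2 * M * e)%N.
have mono (a b : 'I_M) : bounded_span l (ev D ^+ (2 * M) * ev D1 * (y ^+ a * z ^+ b)).
  have la := ltn_ord a; have lb := ltn_ord b.
  have := muluX (inord 1) a _ _ (muluX (inord 2) b _ _
    (muluX (inord 0) (2 * M - a - b)%N _ _ base)).
  rewrite /u !inordK //= mulr1 !exprMn.
  have -> : (e0 + (2 * M - a - b) * e + b * e + a * e = l)%N.
    rewrite /l -!addnA -!mulnDl; congr (_ + _ * _)%N; lia.
  have -> : (2 * M = a + b + (2 * M - a - b))%N by lia.
  rewrite !exprD.
  have -> : (a + b + (2 * M - a - b) - a - b = 2 * M - a - b)%N by lia.
  set da := _ ^+ a; set db := _ ^+ b; set dc := ev D ^+ _.
  congr bounded_span.
  by ring.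
pose val_of (c : {ffun 'I_M * 'I_M -> k}) :=
  ev D ^+ (2 * M) * ev D1 * \sum_i iota (c i) * (y ^+ i.1 * z ^+ i.2).
have val_span f : bounded_span l (val_of f).
  rewrite /val_of mulr_sumr; apply: big_ind; [exact: bounded_span0 | exact: bounded_spanD |].
  by move=> i _; rewrite mulrCA; apply: bounded_spanZ; exact: mono.
have /choice[g gP] f := bounded_span_coefs (val_span f).
have : ~ injective g.
  move=> ginj.
  have : (#|{ffun 'I_M * 'I_M -> k}| <= #|{ffun 'I_n * 'I_l.+1 -> k}|)%N.
    by exact: leq_card ginj.
  rewrite !card_ffun !card_prod !card_ord leq_exp2l; last exact: finNzRing_gt1.
  apply/negP; rewrite -ltnNge /l /M.
  set A := (n * (e0.+1 + 2 * e))%N.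
  have -> : (n * (e0 + 2 * A.+1 * e).+1 = n * e0.+1 + n * (2 * e) * A.+1)%N by lia.
  have : (n * e0.+1 + n * (2 * e) = A)%N by rewrite /A; lia.
  by set B := (n * e0.+1)%N; set C := (n * (2 * e))%N; nia.
move=> ninj; have [f [f' [ff' E]]] : exists f f', f <> f' /\ g f = g f'.
  apply: contrapT => H; apply: ninj => f f' E; apply: contrapT => ff'.
  by apply: H; exists f, f'.
exists M, (f - f'); first by rewrite subr_eq0; apply/eqP.
have : val_of f - val_of f' = 0 by rewrite !gP E subrr.
rewrite /val_of -mulrBr => /eqP.
rewrite mulf_eq0 mulf_eq0 expf_eq0 (negbTE D0) (negbTE D10) andbF /=.
move=> /eqP E0; rewrite -[RHS]E0 -sumrB; apply: eq_bigr => i _.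
by rewrite !ffunE rmorphB mulrBl.
Qed.

End Dependence.

Section Archimedean.
Variables (k : finFieldType) (F : fieldType) (iota : {rmorphism k -> F}).

(** Suppose that every power of t divides x. Then each monomial t^i x^j divides
strictly every lexicographically larger one, j being compared first, so a
linear combination of monomials has the value of its least term and is not 0.
This contradicts algebraic dependence. *)
Lemma place_archimedean (P : place iota) (t x : F) : is_function_field iota ->
  place_ideal P t -> t != 0 -> x != 0 ->
  exists n, ~ exists2 a, place_ring P a & x = a * t ^+ n.
Proof.
move=> [x0 [_ [n [v spanP]]]] Mt t0 xn0; apply: contrapT => H.
have tn i : place_ideal P (x / t ^+ i).
  have [a Oa Ea] : exists2 a, place_ring P a & x = a * t ^+ i.+1.
    by apply: contrapT => H1; apply: H; exists i.+1.
  by rewrite Ea exprS mulrA mulfK ?expf_neq0 //; apply: place_idealMl.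
have [M [c c0 sum0]] := algebraic_dependence spanP t x.
have [[i j] cij] : exists ij, c ij != 0.
  apply: contrapT => H1; move/eqP: c0; apply; apply/ffunP => ij; rewrite ffunE.
  by apply/eqP; apply: contra_notT H1 => ?; exists ij.
(* The lexicographic order as an order on natural numbers. *)
pose key (ab : 'I_M * 'I_M) := (ab.2 * M + ab.1)%N.
case: (@arg_minnP _ (i, j) (fun ab => c ab != 0) key cij) => -[a b] /= cab minab.
have Ma (y : F) : y = t ^+ a * x ^+ b ->
    place_ideal P (\sum_(l | l != (a, b)) iota (c l) * (t ^+ l.1 * x ^+ l.2) / y).
  move=> ->; apply: big_ind; [exact: place_ideal0 | by move=> ? ?; exact: place_idealD |].
  move=> [a' b'] /= ne; have [->|cl] := eqVneq (c (a', b')) 0.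
    by rewrite rmorph0 !mul0r; exact: place_ideal0.
  rewrite -mulrA; apply: place_idealMl; first exact: place_ring_const.
  have := minab _ cl; rewrite /key /= => le.
  have [bb'|bb'] := ltnP b b'.
    have -> : t ^+ a' * x ^+ b' / (t ^+ a * x ^+ b) = t ^+ a' * x ^+ (b' - b).-1 * (x / t ^+ a).
      have -> : (b' = b + ((b' - b).-1.+1) :> nat)%N by lia.
      rewrite exprD exprS addKn; field.
      by rewrite !expf_neq0.
    apply: place_idealMl => //.
    apply: place_ringM; apply: place_ringX; apply: place_ideal_ring => //.
    by have := tn 0%N; rewrite expr0 divr1.
  have Eb : (b' = b :> nat)%N by have := ltn_ord a'; nia.
  have aa' : (a < a')%N.
    rewrite ltn_neqAle; apply/andP; split; last by move: le; rewrite Eb; lia.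
    by apply: contra ne => /eqP Ea; apply/eqP; congr pair; apply: val_inj.
  have -> : t ^+ a' * x ^+ b' / (t ^+ a * x ^+ b) = t ^+ (a' - a).-1 * t.
    have -> : (a' = a + ((a' - a).-1.+1) :> nat)%N by lia.
    rewrite exprD exprS addKn Eb; field.
    by rewrite !expf_neq0.
  by apply: place_idealMl => //; apply: place_ringX; apply: place_ideal_ring.
have y0 : t ^+ a * x ^+ b != 0 by rewrite mulf_neq0 ?expf_neq0.
have := Ma _ erefl; have /eqP := sum0; rewrite (bigD1 (a, b)) //= addr_eq0 => /eqP E.
rewrite -mulr_suml -[X in X / _]opprK -E mulNr mulfK //.
move/place_idealN; rewrite opprK => /place_ideal_const /eqP.
by rewrite (negbTE cab).
Qed.

End Archimedean.

(** * Constant field extensions *)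

Section ConstantExtension.
Variables (k : finFieldType) (F : fieldType) (iota : {rmorphism k -> F}) (r : nat).
Variable E : constant_extension iota r.
Hypothesis full : is_full_constant_field iota.
Local Notation k' := (ce_const E).
Local Notation F' := (ce_field E).
Local Notation j := (ce_iota E).
Local Notation b := (ce_base E).
Local Notation e := (ce_incl E).

Variables (al : k') (mu : {poly k}).
Hypothesis mu_monic : mu \is monic.
Hypothesis size_mu : size mu = r.+1.
Hypothesis muP : forall h, root (map_poly b h) al = (mu %| h).
Hypothesis genal : forall y, exists2 h : {poly k}, (size h <= r)%N & y = (map_poly b h).[al].

Lemma horner_ce_iota (h : {poly k'}) y : (map_poly j h).[j y] = j h.[y].
Proof. exact: horner_map. Qed.

Lemma map_ce (h : {poly k}) : map_poly e (map_poly iota h) = map_poly j (map_poly b h).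
Proof. by rewrite -!map_poly_comp; apply: eq_map_poly => c /=; exact: ce_comm. Qed.

(** Such an x is algebraic over k, and k is the full constant field. *)
Lemma fixed_const (x : F) : x ^+ (#|k| ^ r) = x -> exists c, x = iota c.
Proof.
move=> xq; apply: full; exists ('X^(#|k| ^ r) - 'X).
  have q1 : (1 < #|k| ^ r)%N by rewrite -(ce_card E) finNzRing_gt1.
  by rewrite -size_poly_eq0 size_polyDl size_polyXn // size_polyN size_polyX ltnS.
by rewrite rmorphB /= map_polyXn map_polyX rootE !hornerE xq subrr.
Qed.

(** The minimal polynomial of al over k remains minimal over F. The minimal
polynomial over F divides X^#|k'| - X, so it is a product of factors X - c with
c in k', and its coefficients lie both in F and in k'; hence they lie in k. *)
Lemma alpha_annihilator (f : {poly F}) :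
  root (map_poly e f) (j al) = (map_poly iota mu %| f).
Proof.
have rmu : root (map_poly e (map_poly iota mu)) (j al).
  by rewrite map_ce rootE horner_ce_iota fmorph_eq0 -rootE muP.
have [||p pmon pP] := @annihilator_exists _ _ e (j al) (map_poly iota mu) => //.
  by rewrite map_poly_eq0 monic_neq0.
have dvd : map_poly e p %| \prod_(c <- enum k') ('X - (j c)%:P).
  have -> : \prod_(c <- enum k') ('X - (j c)%:P) = map_poly j ('X^#|k'| - 'X).
    rewrite finField_genPoly rmorph_prod big_enum; apply: eq_bigr => c _ /=.
    by rewrite rmorphB /= map_polyX map_polyC.
  have -> : 'X^#|k'| - 'X = map_poly b ('X^#|k'| - 'X).
    by rewrite rmorphB /= map_polyXn map_polyX.
  rewrite -map_ce dvdp_map -pP map_ce rootE horner_ce_iota fmorph_eq0.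
  by rewrite rmorphB /= map_polyXn map_polyX !hornerE expf_card subrr.
have [ms Dp] := dvdp_prod_XsubC dvd.
have {}Dp : map_poly e p = map_poly j (\prod_(c <- mask ms (enum k')) ('X - c%:P)).
  apply/eqP; rewrite -eqp_monic ?map_monic // ?monic_prod_XsubC //.
  apply: eqp_trans Dp _; rewrite rmorph_prod /=.
  under [X in _ %= X]eq_bigr do rewrite rmorphB /= map_polyX map_polyC.
  exact: eqpxx.
have /choice[c0 c0P] i : exists c, p`_i = iota c.
  apply: fixed_const; apply: (fmorph_inj e).
  rewrite rmorphXn /= -coef_map Dp coef_map /= -rmorphXn /=.
  by rewrite -(ce_card E) expf_card.
pose p0 := \poly_(i < size p) c0 i.
have Dp0 : p = map_poly iota p0.
  apply/polyP => i; rewrite coef_map coef_poly /=; case: ltnP => [_|ip]; first exact: c0P.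
  by rewrite rmorph0 nth_default.
have mup : map_poly iota mu %| p.
  have : root (map_poly e p) (j al) by rewrite pP.
  by rewrite Dp0 map_ce rootE horner_ce_iota fmorph_eq0 -rootE muP dvdp_map.
have pmu : p %| map_poly iota mu by rewrite -pP.
by rewrite pP; apply/idP/idP; exact: dvdp_trans.
Qed.

(** F[al] is a field because the minimal polynomial of al over F is irreducible,
and it contains F and k'. *)
Lemma alpha_generates (z : F') : exists f : {poly F}, z = (map_poly e f).[j al].
Proof.
pose S : {pred F'} := fun z => `[< exists f : {poly F}, z = (map_poly e f).[j al] >].
suff /asboolP[f ->] : z \in S by exists f.
have SP w : reflect (exists f : {poly F}, w = (map_poly e f).[j al]) (w \in S).
  exact: asboolP.
apply: (@ce_gen _ _ _ _ E) => [|x|c]; last 2 first.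
- by apply/SP; exists x%:P; rewrite map_polyC hornerC.
- apply/SP; have [h _ ->] := genal c.
  by exists (map_poly iota h); rewrite map_ce horner_ce_iota.
have SV w : w \in S -> w^-1 \in S.
  move/SP=> [f ->]; have [->|w0] := eqVneq (map_poly e f).[j al] 0.
    by apply/SP; exists 0; rewrite invr0 map_poly0 horner0.
  have mu0 : map_poly iota mu != 0 by rewrite map_poly_eq0 monic_neq0.
  have [_ irr] := annihilator_irreducible alpha_annihilator mu0.
  have : coprimep (map_poly iota mu) f.
    rewrite coprimep_def; apply: contraNT w0 => /irr /(_ (dvdp_gcdl _ _)).
    rewrite -rootE alpha_annihilator => /andP[_] /dvdp_trans; apply.
    exact: dvdp_gcdr.
  case/Bezout_eq1_coprimepP=> -[u v] /= uv.
  apply/SP; exists v; apply: (mulIf w0); rewrite mulVf //.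
  have <- : (map_poly e (1 : {poly F})).[j al] = 1 by rewrite rmorph1 hornerC.
  rewrite -uv rmorphD hornerD /= rmorphM hornerM /=.
  have /eqP -> : root (map_poly e (map_poly iota mu)) (j al) by rewrite alpha_annihilator.
  by rewrite mulr0 add0r rmorphM hornerM.
split.
- by apply/SP; exists 1; rewrite rmorph1 hornerC.
- move=> x y /SP[f ->] /SP[g ->]; apply/SP; exists (f - g).
  by rewrite rmorphB hornerD hornerN.
- move=> x y /SP[f ->] /SV/SP[g ->]; apply/SP; exists (f * g).
  by rewrite rmorphM hornerM.
Qed.

(** * Extension of a place along an embedding of its residue field *)

Section OverPlace.
Variables (P : place iota) (K : finFieldType) (rho : {rmorphism vring P -> K}).
Hypothesis rho_ker : forall x, rho x = 0 <-> place_ideal P (val x).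
Variable psi : {rmorphism K -> k'}.
Hypothesis psi_const : forall c, psi (rho (vring_const P c)) = b c.

(** A polynomial f over O_P represents the element f(al) of O_P[al], computed in F'
by [realize]; its residue along psi is computed in k' by [specialize]. *)
Definition specialize (f : {poly vring P}) : k' := (map_poly (psi \o rho) f).[al].
Definition realize (f : {poly vring P}) : F' := (map_poly (e \o val) f).[j al].
HB.instance Definition _ := GRing.RMorphism.copy specialize
  (horner_eval al \o map_poly (psi \o rho)).
HB.instance Definition _ := GRing.RMorphism.copy realize
  (horner_eval (j al) \o map_poly (e \o val)).

Lemma specializeC x : specialize x%:P = psi (rho x).
Proof. by rewrite /specialize map_polyC hornerC. Qed.

Lemma realizeC x : realize x%:P = e (val x).
Proof. by rewrite /realize map_polyC hornerC. Qed.

Lemma specialize_const h : specialize (map_poly (vring_const P) h) = (map_poly b h).[al].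
Proof.
rewrite /specialize -map_poly_comp; congr (_.[_]).
by apply: eq_map_poly => c /=; exact: psi_const.
Qed.

Lemma realize_const h : realize (map_poly (vring_const P) h) = j (map_poly b h).[al].
Proof.
rewrite /realize -map_poly_comp -horner_ce_iota -map_ce -map_poly_comp.
by congr (_.[_]); apply: eq_map_poly => c /=; rewrite vring_constE.
Qed.

Lemma const_lift c : exists2 h, realize h = j c & specialize h = c.
Proof.
have [h _ ->] := genal c; exists (map_poly (vring_const P) h).
  exact: realize_const.
exact: specialize_const.
Qed.

(** The specialisation of O_P[al] is well defined: division with remainder by the
monic polynomial mu, carried out over O_P, leaves 0, since mu stays minimal
over F; and mu(al) = 0 in k' too. *)
Lemma realize_eq0 f : realize f = 0 -> specialize f = 0.
Proof.
pose muO := map_poly (vring_const P) mu.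
have muOmon : muO \is monic by exact: monic_map.
have szmuO : size muO = r.+1.
  by rewrite -size_mu size_map_poly_id0 // (eqP mu_monic) rmorph1 oner_neq0.
have mual : (map_poly b mu).[al] = 0 by apply/eqP; rewrite -rootE muP.
have rm := Pdiv.RingMonic.rdivp_eq muOmon f.
have lt : (size (Pdiv.Ring.rmodp f muO) <= r)%N.
  by rewrite -ltnS -szmuO Pdiv.Ring.ltn_rmodp monic_neq0.
move: rm lt; move: (Pdiv.Ring.rdivp _ _) (Pdiv.Ring.rmodp _ _) => g s -> ss.
rewrite !rmorphD !rmorphM /= realize_const specialize_const mual rmorph0.
rewrite !mulr0 !add0r => s0.
suff -> : s = 0 by rewrite rmorph0.
pose s' : {poly F} := map_poly val s.
have ss' : (size s' <= r)%N by apply: leq_trans (size_poly _ _) ss.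
have : root (map_poly e s') (j al).
  by rewrite rootE -map_poly_comp; apply/eqP.
rewrite alpha_annihilator => dv.
have : s' == 0.
  apply: contraTT dv => s'0; apply/negP=> /(dvdp_leq s'0).
  by rewrite size_map_poly size_mu leqNgt ltnS ss'.
move/eqP=> s'0; apply/polyP => i; apply: val_inj; rewrite coef0 rmorph0.
by have := coef_map (val : {rmorphism vring P -> F}) s i; rewrite -/s' s'0 coef0 => <-.
Qed.

(** The localisation of O_P[al] at the kernel of the specialisation. *)
Definition ext_ring : set F' := [set z | exists f g,
  specialize g != 0 /\ z * realize g = realize f].

Definition ext_unit : set F' := [set z | exists f g,
  [/\ specialize f != 0, specialize g != 0 & z * realize g = realize f]].

Lemma realize_neq0 g : specialize g != 0 -> realize g != 0.
Proof. by apply: contra_neq; exact: realize_eq0. Qed.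

Lemma ext_realize f : ext_ring (realize f).
Proof. by exists f, 1; rewrite !rmorph1 oner_neq0 mulr1. Qed.

Lemma ext_ringB x y : ext_ring x -> ext_ring y -> ext_ring (x - y).
Proof.
move=> [f [g [g0 xg]]] [f' [g' [g'0 yg]]]; exists (f * g' - f' * g), (g * g').
by rewrite rmorphB !rmorphM mulf_neq0 //= -xg -yg mulrBl !mulrA (mulrAC y).
Qed.

Lemma ext_ringM x y : ext_ring x -> ext_ring y -> ext_ring (x * y).
Proof.
move=> [f [g [g0 xg]]] [f' [g' [g'0 yg]]]; exists (f * f'), (g * g').
by rewrite !rmorphM mulf_neq0 //= -xg -yg mulrACA.
Qed.

Lemma ext_ring0 : ext_ring 0.
Proof. by rewrite -(rmorph0 realize); exact: ext_realize. Qed.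

Lemma ext_ringN x : ext_ring x -> ext_ring (- x).
Proof. by rewrite -sub0r; apply: ext_ringB; exact: ext_ring0. Qed.

Lemma ext_ringD x y : ext_ring x -> ext_ring y -> ext_ring (x + y).
Proof. by move=> ex /ext_ringN ey; rewrite -[y]opprK; exact: ext_ringB. Qed.

Lemma ext_vring x : ext_ring (e (val (x : vring P))).
Proof. by rewrite -realizeC; exact: ext_realize. Qed.

Lemma ext_const c : ext_ring (j c).
Proof. by have [h <- _] := const_lift c; exact: ext_realize. Qed.

Lemma ext_unit_ring z : ext_unit z -> ext_ring z.
Proof. by move=> [f [g [_ g0 zg]]]; exists f, g. Qed.

Lemma ext_unit_neq0 z : ext_unit z -> z != 0.
Proof.
move=> [f [g [f0 _ zg]]]; apply: contraNneq (realize_neq0 f0) => z0.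
by rewrite -zg z0 mul0r.
Qed.

Lemma ext_unitV z : ext_unit z -> ext_unit z^-1.
Proof.
move=> uz; have z0 := ext_unit_neq0 uz; have [f [g [f0 g0 zg]]] := uz.
by exists g, f; split=> //; rewrite -zg mulKf.
Qed.

(** If e x were in the localisation with x outside O_P, the residue 0 of 1/x would
force a denominator to have residue 0. *)
Lemma ext_incl x : ext_ring (e x) <-> place_ring P x.
Proof.
split=> [[f [g [g0 xg]]]|/vring_lift[y <-]]; last exact: ext_vring.
apply: contrapT => nOx; have Mx := place_idealV nOx.
have x0 : x != 0.
  by apply/eqP=> x0; apply: nOx; rewrite x0; exact: place_ring0.
have [y Dy] := vring_lift (place_ideal_ring Mx).
move/negP: g0; apply; apply/eqP.
have : realize (g - y%:P * f) = 0.
  by rewrite rmorphB rmorphM /= realizeC Dy -xg fmorphV mulKf ?subrr ?fmorph_eq0.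
move/realize_eq0; rewrite rmorphB rmorphM /= specializeC => /eqP.
have -> : rho y = 0 by apply/rho_ker; rewrite Dy.
by rewrite rmorph0 mul0r subr0 => /eqP.
Qed.

Lemma const_lift_poly (g : {poly k'}) (x : vring P) :
  exists2 f, realize f = (map_poly j g).[e (val x)] & specialize f = g.[psi (rho x)].
Proof.
elim/poly_ind: g => [|g c [f rf sf]].
  by exists 0; rewrite ?rmorph0 ?map_poly0 horner0.
have [h rh sh] := const_lift c; exists (f * x%:P + h).
  by rewrite rmorphD rmorphM /= realizeC rf rh rmorphD rmorphM /= map_polyX map_polyC !hornerE.
by rewrite rmorphD rmorphM /= specializeC sf sh !hornerE.
Qed.

(** Here m and zeta present the residue field K over k, beta lifts zeta, and m2 and
eta present k' over K through psi. The aim is [realize_factor]: an element of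
O_P[al] is an element of F times a unit of the localisation. *)
Section Approximation.
Variables (d : nat) (m : {poly k}) (zeta : K) (beta : vring P).
Variables (s : nat) (m2 : {poly K}) (eta : k').
Hypothesis d_gt0 : (0 < d)%N.
Hypothesis cardK : #|K| = (#|k| ^ d)%N.
Hypothesis m_monic : m \is monic.
Hypothesis mP : forall h, root (map_poly (rho \o vring_const P) h) zeta = (m %| h).
Hypothesis genK : forall y, exists2 h : {poly k}, (size h <= d)%N
  & y = (map_poly (rho \o vring_const P) h).[zeta].
Hypothesis rho_beta : rho beta = zeta.
Hypothesis m2_monic : m2 \is monic.
Hypothesis size_m2 : size m2 = s.+1.
Hypothesis m2P : forall h, root (map_poly psi h) eta = (m2 %| h).
Hypothesis gen2 : forall y, exists2 h : {poly K}, (size h <= s)%N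
  & y = (map_poly psi h).[eta].

Let a := psi zeta.

Lemma psi_horner h : psi (map_poly (rho \o vring_const P) h).[zeta] = (map_poly b h).[a].
Proof.
rewrite -horner_map -map_poly_comp; congr (_.[_]).
by apply: eq_map_poly => c /=; exact: psi_const.
Qed.

Lemma root_a : root (map_poly b m) a.
Proof. by rewrite rootE -psi_horner fmorph_eq0 -rootE mP. Qed.

(** Raising to the power q^(d n) fixes K, so all these elements lift zeta, whereas
it raises m(beta), which has residue 0, to a high power ([pi_approxE]). *)
Definition beta_approx n : vring P := beta ^+ (#|k| ^ (d * n)).
Definition pi_approx n : F := (map_poly iota m).[val beta] ^+ (#|k| ^ (d * n)).

Lemma pi_approxE n : pi_approx n = (map_poly iota m).[val (beta_approx n)].
Proof. by rewrite /pi_approx frobenius_horner rmorphXn. Qed.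

Lemma rho_beta_approx n : rho (beta_approx n) = zeta.
Proof. by rewrite rmorphXn /= rho_beta expnM -cardK expf_card_exp. Qed.

(** Write m = g (X - a) over k' and evaluate at the approximation, whose residue
is a. As a is a simple root, the value of g is a unit. *)
Lemma beta_approxP n : exists2 v, ext_ring v & j a = e (val (beta_approx n)) + e (pi_approx n) * v.
Proof.
have [g Dg ga] := conjugate_root_simple cardK (ce_card E) d_gt0 m_monic mP genK root_a.
have [f rf sf] := const_lift_poly g (beta_approx n).
have sf0 : specialize f != 0 by rewrite sf rho_beta_approx.
exists (- (realize f)^-1).
  apply/ext_ringN/ext_unit_ring/ext_unitV; exists f, 1.
  by rewrite !rmorph1 oner_neq0 mulr1.
have : e (pi_approx n) = realize f * (e (val (beta_approx n)) - j a).
  rewrite pi_approxE -horner_map map_ce Dg rf rmorphM hornerM; congr (_ * _).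
  by rewrite rmorphB /= map_polyX map_polyC !hornerE.
by move=> ->; rewrite mulrN mulrAC mulfV ?realize_neq0 // mul1r opprB addrC subrK.
Qed.

Lemma horner_approxP n (h : {poly k}) : exists2 v, ext_ring v &
  j (map_poly b h).[a] =
    e (val (map_poly (vring_const P) h).[beta_approx n]) + e (pi_approx n) * v.
Proof.
elim/poly_ind: h => [|h c [v ev IH]].
  exists 0; first exact: ext_ring0.
  by rewrite !map_poly0 !horner0 !rmorph0 mulr0 addr0.
have [v0 ev0 E0] := beta_approxP n.
rewrite !rmorphD !rmorphM /= !map_polyX !map_polyC /= !hornerE.
rewrite !rmorphD !rmorphM /= IH E0 vring_constE ce_comm.
set H := e (val _.[_]); set B := e (val _); set t := e _.
exists (v * B + H * v0 + t * v * v0); last by ring.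
have Ht : ext_ring t.
  by apply/ext_incl; rewrite pi_approxE -vring_horner_const; exact: vringP.
apply: ext_ringD; last by do 2?apply: ext_ringM.
by apply: ext_ringD; apply: ext_ringM => //; exact: ext_vring.
Qed.

(** The s powers of eta form a basis of k' over K, but they span only part of F'
over F unless K = k; hence the error term. *)
Definition approximable n (z : F') := exists x : nat -> vring P, exists2 v, ext_ring v &
  z = \sum_(l < s) e (val (x l)) * j (eta ^+ l) + e (pi_approx n) * v.

(** Express y along the powers of eta with coefficients in psi K = k[a], and
replace a in each coefficient by its approximation in O_P. *)
Lemma approximable_const n y : approximable n (j y).
Proof.
have [h sh ->] := gen2 y.
have /choice[u uP] l : exists u : {poly k}, h`_l = (map_poly (rho \o vring_const P) u).[zeta].
  by have [u _ Du] := genK h`_l; exists u.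
have /choice[v vP] l : exists v, ext_ring v /\
   j (map_poly b (u l)).[a] =
     e (val (map_poly (vring_const P) (u l)).[beta_approx n]) + e (pi_approx n) * v.
  by have [v] := horner_approxP n (u l); exists v.
exists (fun l => (map_poly (vring_const P) (u l)).[beta_approx n]),
  (\sum_(l < s) v l * j (eta ^+ l)).
  apply: big_ind; [exact: ext_ring0 | exact: ext_ringD |].
  by move=> l _; apply: ext_ringM; [exact: (vP l).1 | exact: ext_const].
rewrite (@horner_coef_wide _ s) ?size_map_poly // rmorph_sum mulr_sumr -big_split.
apply: eq_bigr => l _ /=; rewrite rmorphM coef_map /= uP psi_horner (vP l).2.
by rewrite mulrDl mulrA.
Qed.

Lemma approximableD n y z : approximable n y -> approximable n z -> approximable n (y + z).
Proof.
move=> [x [v ev ->]] [x' [v' ev' ->]]; exists (fun l => x l + x' l), (v + v').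
  exact: ext_ringD.
rewrite addrACA -mulrDr -big_split; congr (_ + _).
by apply: eq_bigr => l _; rewrite !rmorphD mulrDl.
Qed.

Lemma approximableZ n (c : vring P) z : approximable n z -> approximable n (e (val c) * z).
Proof.
move=> [x [v ev ->]]; exists (fun l => c * x l), (e (val c) * v).
  by apply: ext_ringM => //; exact: ext_vring.
rewrite mulrDr mulrCA mulr_sumr; congr (_ + _).
by apply: eq_bigr => l _; rewrite !rmorphM mulrA.
Qed.

Lemma approximable_realize n f : approximable n (realize f).
Proof.
rewrite /realize (@horner_coef_wide _ (size f)) ?size_poly //.
elim/big_ind: _; [|exact: approximableD|].
  by rewrite -(rmorph0 j); exact: approximable_const.
move=> i _; rewrite coef_map -rmorphXn; apply: approximableZ; exact: approximable_const.
Qed.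

(** The residue is a nontrivial combination over K of powers of eta that are
linearly independent over K. *)
Lemma combination_unit (y : nat -> vring P) (p : vring P) v l0 : (l0 < s)%N ->
  rho (y l0) != 0 -> rho p = 0 -> ext_ring v ->
  ext_unit (\sum_(l < s) e (val (y l)) * j (eta ^+ l) + e (val p) * v).
Proof.
move=> l0s yl0 p0 [f [g [g0 vg]]].
have /choice[H HP] l : exists H, realize H = j (eta ^+ l) /\ specialize H = eta ^+ l.
  by have [H] := const_lift (eta ^+ l); exists H.
exists ((\sum_(l < s) (y l)%:P * H l) * g + p%:P * f), g; split=> //; last first.
  rewrite rmorphD !rmorphM rmorph_sum /= realizeC -vg mulrDl mulrA; congr (_ * _ + _).
  by apply: eq_bigr => l _; rewrite rmorphM /= realizeC (HP l).1.
rewrite rmorphD !rmorphM rmorph_sum /= specializeC p0 rmorph0 mul0r addr0 mulf_neq0 //.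
pose h := \poly_(l < s) rho (y l).
have -> : \sum_(l < s) specialize ((y l)%:P * H l) = (map_poly psi h).[eta].
  rewrite (@horner_coef_wide _ s) ?size_map_poly ?size_poly //.
  apply: eq_bigr => l _; rewrite rmorphM /= specializeC (HP l).2 coef_map coef_poly.
  by rewrite ltn_ord.
rewrite -[X in X != _]/(_.[_]) -/(root _ _) m2P.
have h0 : h != 0.
  have : h`_l0 = rho (y l0) by rewrite coef_poly l0s.
  by move=> E0; apply: contraNneq yl0 => h0; rewrite -E0 h0 coef0.
by apply/negP=> /(dvdp_leq h0); rewrite size_m2 leqNgt ltnS size_poly.
Qed.

Lemma exists_dividing_term (y : nat -> vring P) n : (0 < n)%N -> exists2 l0, (l0 < n)%N &
  forall l, (l < n)%N -> exists c, y l = c * y l0.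
Proof.
elim: n => // [[|n]] IH _.
  by exists 0%N => // -[|//] _; exists 1; rewrite mul1r.
have [l0 l0n Hl0] := IH isT.
have [[c Oc Ec]|[c Oc Ec]] := place_ring_total P (val (y n.+1)) (val (y l0)).
  exists l0; first exact: leqW.
  move=> l; rewrite ltnS leq_eqVlt => /orP[/eqP->|]; last exact: Hl0.
  by have [c' Dc] := vring_lift Oc; exists c'; apply: val_inj; rewrite rmorphM /= Dc.
have [c' Dc] := vring_lift Oc.
exists n.+1 => // l; rewrite ltnS leq_eqVlt => /orP[/eqP->|]; first by exists 1; rewrite mul1r.
move/Hl0=> [c1 ->]; exists (c1 * c'); rewrite -mulrA; congr (_ * _).
by apply: val_inj; rewrite rmorphM /= Dc.
Qed.

Lemma vring_denominator (p : {poly F}) : exists2 c : vring P, c != 0 &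
  exists f : {poly vring P}, map_poly val f = val c *: p.
Proof.
elim/poly_ind: p => [|p x [c c0 [f Df]]].
  by exists 1; [exact: oner_neq0 | exists 0; rewrite map_poly0 scaler0].
have [c' c'0 [x' Dx']] : exists2 c' : vring P, c' != 0 & exists x' : vring P, val x' = val c' * x.
  have [x0|x0] := eqVneq x 0.
    by exists 1; [exact: oner_neq0 | exists 0; rewrite x0 mulr0 rmorph0].
  have [/vring_lift[x' Dx]|/vring_lift[x' Dx]] := place_ringV P x0.
    by exists 1; [exact: oner_neq0 | exists x'; rewrite rmorph1 mul1r].
  exists x'; last by exists 1; rewrite Dx mulVf // rmorph1.
  by rewrite -vring_val_eq0 Dx invr_eq0.
exists (c' * c).
  by rewrite -vring_val_eq0 rmorphM mulf_neq0 // vring_val_eq0.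
exists (c' *: f * 'X + (c * x')%:P).
have [vl vlE] : exists vl : {rmorphism vring P -> F}, forall y, val y = vl y by exists val.
rewrite (eq_map_poly vlE) vlE.
have {}Df : map_poly vl f = (vl c)%:P * p by rewrite mul_polyC -vlE -Df; exact/esym/eq_map_poly.
have {}Dx' : vl x' = vl c' * x by rewrite -!vlE.
rewrite rmorphD rmorphM /= map_polyX map_polyC map_polyZ Df -!mul_polyC /=.
by rewrite !rmorphM /= Dx' !rmorphM /=; ring.
Qed.

Hypothesis funF : is_function_field iota.

Lemma pi_ideal : place_ideal P (map_poly iota m).[val beta].
Proof.
rewrite -vring_horner_const; apply/rho_ker.
rewrite -horner_map rho_beta -map_poly_comp.
by apply/eqP; rewrite -rootE mP.
Qed.

(** If m(beta) = 0, the approximations are exact, and n = 0 works since x is not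
0. Otherwise the exponent q^(d n) exceeds the one given by the archimedean
property. *)
Lemma pi_approx_small (x : F) : x != 0 ->
  exists n, ~ exists2 c, place_ring P c & x = c * pi_approx n.
Proof.
move=> x0; have [p0|p0] := eqVneq (map_poly iota m).[val beta] 0.
  exists 0%N; rewrite /pi_approx p0 muln0 expr1 => -[c _ Ex].
  by move: x0; rewrite Ex mulr0 eqxx.
have [N HN] := place_archimedean funF pi_ideal p0 x0.
exists N => -[c Oc Ex]; apply: HN.
have le : (N <= #|k| ^ (d * N))%N.
  apply: ltnW; apply: leq_trans (ltn_expl N (finNzRing_gt1 k)) _.
  by rewrite leq_exp2l ?finNzRing_gt1 // leq_pmull.
exists (c * (map_poly iota m).[val beta] ^+ (#|k| ^ (d * N) - N)).
  by apply: place_ringM => //; apply: place_ringX; apply: place_ideal_ring; exact: pi_ideal.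
by rewrite Ex /pi_approx -{1}(subnK le) exprD mulrA.
Qed.

(** Take x0 in F, nonzero, that is a multiple of z = f(al) in O_P[al], and an
approximation of z with an error that does not divide x0. If the error divided
all the coefficients of the approximation it would divide z, hence x0. So the
coefficient that divides all the others also divides the error, with a quotient
in the ideal of P; factoring it out leaves a unit. *)
Lemma realize_factor f : realize f != 0 ->
  exists2 c : F, c != 0 & exists2 u, ext_unit u & realize f = e c * u.
Proof.
move=> z0; set z := realize f in z0 *.
(* x0 = z w, where w clears the denominators of the inverse of z. *)
have [p Dp] := alpha_generates (z^-1).
have [x0 x00 [w Dw]] := vring_denominator p.
have zw : e (val x0) = z * realize w.
  rewrite /realize map_poly_comp Dw map_polyZ hornerZ -Dp.
  by rewrite mulrCA mulfV ?mulr1.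
have vx0 : val x0 != 0 by rewrite vring_val_eq0.
have [n Hn] := pi_approx_small vx0.
have [x [v ev Ez]] := approximable_realize n f; rewrite -/z in Ez.
have s0 : (0 < s)%N.
  rewrite lt0n; apply/eqP=> s0; have := size_m2; rewrite s0.
  have /annihilator_irreducible := m2P.
  by move=> /(_ (monic_neq0 m2_monic))[+ _] => + E1; rewrite E1.
have [l0 l0s Hl0] := exists_dividing_term x s0.
have /choice[y yP] l : exists c, (l < s)%N -> x l = c * x l0.
  by case: (ltnP l s) => [/Hl0[c ->]|_]; [exists c | exists 0].
have notdvd : ~ exists2 c, place_ring P c & val (x l0) = c * pi_approx n.
  move=> [c Oc Ec]; apply: Hn.
  have [v' ev' zv'] : exists2 v', ext_ring v' & z = e (pi_approx n) * v'.
    exists (\sum_(l < s) e (val (y l)) * e c * j (eta ^+ l) + v).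
      apply: ext_ringD => //; apply: big_ind; [exact: ext_ring0 | exact: ext_ringD |].
      move=> l _; apply: ext_ringM; last exact: ext_const.
      by apply: ext_ringM; [exact: ext_vring | apply/ext_incl].
    rewrite Ez mulrDr mulr_sumr; congr (_ + _); apply: eq_bigr => l _.
    by rewrite yP // rmorphM /= Ec !rmorphM; ring.
  have t0 : pi_approx n != 0.
    apply: contraNneq z0 => t0; by rewrite zv' t0 rmorph0 mul0r.
  exists (val x0 / pi_approx n); last by rewrite divfK.
  apply/ext_incl; rewrite fmorph_div zw zv' -mulrA mulrC mulKf ?fmorph_eq0 //.
  by apply: ext_ringM => //; exact: ext_realize.
have xl0 : val (x l0) != 0.
  by apply/eqP=> xl0; apply: notdvd; exists 0; rewrite ?mul0r //; exact: place_ring0.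
have [p' Dp' p'0] : exists2 p' : vring P, pi_approx n = val p' * val (x l0) & rho p' = 0.
  have [E0|t0] := eqVneq (pi_approx n) 0.
    by exists 0; rewrite ?rmorph0 ?mul0r.
  have : ~ place_ring P (val (x l0) / pi_approx n).
    by move=> Ot; apply: notdvd; exists (val (x l0) / pi_approx n) => //; rewrite divfK.
  move/place_idealV; rewrite invf_div => Mt.
  have [p' Dp'] := vring_lift (place_ideal_ring Mt); exists p'; first by rewrite Dp' divfK.
  by apply/rho_ker; rewrite Dp'.
exists (val (x l0)) => //.
exists (\sum_(l < s) e (val (y l)) * j (eta ^+ l) + e (val p') * v).
  apply: (@combination_unit _ _ _ l0) => //.
  have -> : y l0 = 1; last by rewrite rmorph1 oner_neq0.
  apply: val_inj; apply: (mulIf xl0).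
  by rewrite rmorph1 mul1r; have := congr1 val (yP _ l0s); rewrite rmorphM => /esym.
rewrite Ez mulrDr mulr_sumr Dp'; congr (_ + _); last by rewrite rmorphM; ring.
by apply: eq_bigr => l _; rewrite yP // !rmorphM /=; ring.
Qed.

Lemma ext_ring_total z : z != 0 -> ext_ring z \/ ext_ring z^-1.
Proof.
move=> z0; have [p Dp] := alpha_generates z.
have [c c0 [w Dw]] := vring_denominator p.
have vc0 : val c != 0 by rewrite vring_val_eq0.
have zw : e (val c) * z = realize w.
  by rewrite /realize map_poly_comp Dw map_polyZ hornerZ -Dp.
have w0 : realize w != 0 by rewrite -zw mulf_neq0 // fmorph_eq0.
have [c1 c10 [u uu Eu]] := realize_factor w0.
have Dz : z = e (c1 / val c) * u.
  rewrite fmorph_div mulrAC -Eu -zw /= mulrAC mulfV ?mul1r //.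
  by rewrite fmorph_eq0.
have /(place_ringV P)[O1|O1] : c1 / val c != 0 by rewrite mulf_neq0 ?invr_eq0.
  by left; rewrite Dz; apply: ext_ringM; [apply/ext_incl | exact: ext_unit_ring].
right; rewrite Dz invfM -fmorphV; apply: ext_ringM; first exact/ext_incl.
by apply/ext_unit_ring/ext_unitV.
Qed.

Lemma ext_valuation_ring : is_valuation_ring (ce_iota E) ext_ring.
Proof.
split; [exact: ext_const | exact: ext_ringB | exact: ext_ringM | | exact: ext_ring_total].
have [_ _ _ [z Oz] _] := place_ringP P.
by exists (e z) => /ext_incl.
Qed.

Definition ext_place : place (ce_iota E) := Place ext_valuation_ring.

Lemma ext_place_ideal z f g : specialize g != 0 -> z * realize g = realize f ->
  place_ideal ext_place z <-> specialize f = 0.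
Proof.
move=> g0 zg; split=> [[_ Mz]|f0].
  apply/eqP; apply: contrapT => /negP f0.
  have uz : ext_unit z by exists f, g.
  case: Mz => [z0|]; last by apply; exact/ext_unit_ring/ext_unitV.
  by move: (ext_unit_neq0 uz); rewrite z0 eqxx.
split; first by exists f, g.
have [->|z0] := eqVneq z 0; [by left | right=> -[f' [g' [g'0 zg']]]].
have : realize (g * g' - f * f') = 0.
  by rewrite rmorphB !rmorphM /= -zg -zg' mulrACA mulfV // mul1r mulrC subrr.
move/realize_eq0/eqP; rewrite rmorphB !rmorphM /= f0 mul0r subr0 mulf_eq0.
by rewrite (negbTE g0) (negbTE g'0).
Qed.

Lemma ext_place_residue z f g : specialize g != 0 -> z * realize g = realize f ->
  has_residue ext_place z (specialize f / specialize g).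
Proof.
move=> g0 zg; have [h rh sh] := const_lift (specialize f / specialize g).
apply/(@ext_place_ideal _ (f - h * g) g) => //.
  by rewrite mulrBl zg -rh -rmorphM -rmorphB.
by rewrite rmorphB rmorphM /= sh divfK // subrr.
Qed.

Lemma ext_place_degree : place_degree ext_place = 1%N.
Proof.
apply/place_degree1P => z [f [g [g0 zg]]]; exists (specialize f / specialize g).
exact: ext_place_residue.
Qed.

Lemma ext_place_beta : has_residue ext_place (e (val beta)) a.
Proof.
have := @ext_place_residue (e (val beta)) beta%:P 1.
rewrite !rmorph1 specializeC rho_beta divr1; apply; first exact: oner_neq0.
by rewrite realizeC mulr1.
Qed.

(** The data determine the residues of O_P = k[beta] + M_P in Q, hence those of
O_P[al], so that O_Q dominates the localisation. *)
Lemma ext_place_unique (Q : place (ce_iota E)) :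
  (forall x, place_ring Q (e x) <-> place_ring P x) ->
  has_residue Q (e (val beta)) a -> Q = ext_place.
Proof.
move=> QP Qbeta.
have MPQ x : place_ideal P x -> place_ideal Q (e x).
  move=> [Ox [->|Ox']]; first by rewrite rmorph0; exact: place_ideal0.
  by split; [exact/QP | right; rewrite -fmorphV => /QP].
have Qvring (x : vring P) : has_residue Q (e (val x)) (psi (rho x)).
  have [h _ Dh] := genK (rho x); pose y := (map_poly (vring_const P) h).[beta].
  have ry : rho y = rho x by rewrite /y -horner_map rho_beta -map_poly_comp.
  have vy : val y = (map_poly iota h).[val beta] := vring_horner_const h beta.
  have Qy : has_residue Q (e (val y)) (psi (rho x)).
    rewrite vy -horner_map map_ce Dh psi_horner; exact: has_residue_horner.
  have Qxy : has_residue Q (e (val (x - y))) 0.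
    by apply/has_residue0/MPQ/rho_ker; rewrite rmorphB /= ry subrr.
  have := has_residueD Qxy Qy.
  by rewrite -rmorphD -rmorphD /= subrK add0r.
have Qrealize f : has_residue Q (realize f) (specialize f).
  elim/poly_ind: f => [|f x IH].
    by rewrite !rmorph0; apply/has_residue0/place_ideal0.
  rewrite !rmorphD !rmorphM /= specializeC realizeC.
  apply: has_residueD; last exact: Qvring.
  apply: has_residueM => //.
  by rewrite /realize /specialize !map_polyX !hornerX; exact: has_residue_const.
have Qz z f g : specialize g != 0 -> z * realize g = realize f ->
    z = (realize g)^-1 * realize f /\ place_ring Q (realize g)^-1.
  move=> g0 zg; have [rg0 Og] := has_residue_unit (Qrealize g) g0.
  by rewrite -zg mulrC mulfK.
apply/esym/place_dominate => [z [f [g [g0 zg]]]|z Mz].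
  have [-> Og] := Qz _ _ _ g0 zg; apply: place_ringM => //.
  exact: has_residue_ring (Qrealize f).
have [f [g [g0 zg]]] := place_ideal_ring Mz.
have f0 := (ext_place_ideal g0 zg).1 Mz.
have [-> Og] := Qz _ _ _ g0 zg; apply: place_idealMl => //.
by apply/has_residue0; rewrite -f0.
Qed.

End Approximation.
End OverPlace.

(** Reduce m(beta), which lies in the ideal of P, modulo Q. *)
Lemma degree_one_place_root (P : place iota) (m : {poly k}) (beta : vring P)
    (Q : place (ce_iota E)) :
  (forall x, place_ring Q (e x) <-> place_ring P x) ->
  place_degree Q = 1%N -> place_ideal P (map_poly iota m).[val beta] ->
  exists2 c, root (map_poly b m) c & has_residue Q (e (val beta)) c.
Proof.
move=> QP /place_degree1P Q1 [Om Mm].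
have [c Qc] : exists c, has_residue Q (e (val beta)) c by apply/Q1/QP/vringP.
exists c => //; apply/eqP.
have := has_residue_horner (map_poly b m) Qc; rewrite -map_ce horner_map.
move/has_residue_uniq; apply; apply/has_residue0.
split; first exact/QP.
by case: Mm => [->|Om']; [left; rewrite rmorph0 | right; rewrite -fmorphV => /QP].
Qed.

End ConstantExtension.

(** * Places of degree one above a given place *)

Section PlacesAbove.
Variables (k : finFieldType) (F : fieldType) (iota : {rmorphism k -> F}) (r : nat).
Variable E : constant_extension iota r.
Hypothesis full : is_full_constant_field iota.
Hypothesis funF : is_function_field iota.

Definition degree_one_places_above (P : place iota) : set (place (ce_iota E)) :=
  [set Q | place_degree Q = 1%N /\
           forall x, place_ring Q (ce_incl E x) <-> place_ring P x].

(** If O_Q contained F, it would contain F[al] = F.k', as it contains k'. *)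
Lemma place_below_ex (Q : place (ce_iota E)) :
  exists P : place iota, forall x, place_ring Q (ce_incl E x) <-> place_ring P x.
Proof.
have [al [mu [mu_monic size_mu muP genal]]] :=
  finite_field_simple_extension (ce_base E) (ce_card E).
suff vr : is_valuation_ring iota [set x | place_ring Q (ce_incl E x)] by exists (Place vr).
split=> [c|x y|x y||z z0] /=.
- by rewrite ce_comm; exact: place_ring_const.
- by rewrite rmorphB; exact: place_ringB.
- by rewrite rmorphM; exact: place_ringM.
- apply: contrapT => H; have [_ _ _ [z nQz] _] := place_ringP Q; apply: nQz.
  have [f ->] := alpha_generates full mu_monic muP genal z.
  rewrite horner_coef; apply: place_ring_sum => i _; apply: place_ringM.
    by rewrite coef_map; apply: contrapT => nQ; apply: H; exists f`_i.
  by apply: place_ringX; exact: place_ring_const.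
- by rewrite fmorphV; apply: place_ringV; rewrite fmorph_eq0.
Qed.

(** The places correspond to the roots in k' of the minimal polynomial m of a
generator of the residue field, through the residue of a lift beta of this
generator. *)
Lemma card_degree_one_places_above (P : place iota) : (0 < place_degree P)%N ->
  (degree_one_places_above P #=
     `I_(if (place_degree P %| r)%N then place_degree P else 0%N))%card.
Proof.
move=> d0; set d := place_degree P in d0 *.
have [al [mu [mu_monic size_mu muP genal]]] :=
  finite_field_simple_extension (ce_base E) (ce_card E).
have [K [rho [rho_surj rho_ker cardK]]] := residue_field d0.
have [zeta [m [m_monic size_m mP genK]]] :=
  finite_field_simple_extension (rho \o vring_const P) cardK.
have [beta rho_beta] := rho_surj zeta.
pose roots := [set c | root (map_poly (ce_base E) m) c].
have mb : place_ideal P (map_poly iota m).[val beta].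
  rewrite -vring_horner_const; apply/rho_ker.
  rewrite -horner_map rho_beta -map_poly_comp.
  by apply/eqP; rewrite -rootE mP.
have /choice[res resP] Q : exists c, degree_one_places_above P Q ->
    root (map_poly (ce_base E) m) c /\ has_residue Q (ce_incl E (val beta)) c.
  have [[Q1 QP]|nQ] := pselect (degree_one_places_above P Q); last by exists 0.
  by have [c] := degree_one_place_root QP Q1 mb; exists c.
have exQ c : roots c -> exists2 Q : place (ce_iota E),
    degree_one_places_above P Q /\ has_residue Q (ce_incl E (val beta)) c &
    forall Q', degree_one_places_above P Q' ->
      has_residue Q' (ce_incl E (val beta)) c -> Q' = Q.
  move=> rc; have [psi psi_zeta psi_const] := conjugate_embedding m_monic mP genK rc.
  have /dvdnP[s Er] := root_generator_dvd cardK (ce_card E) d0 m_monic mP genK rc.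
  have cardE : #|ce_const E| = (#|K| ^ s)%N by rewrite (ce_card E) cardK -expnM mulnC -Er.
  have [eta [m2 [m2_monic size_m2 m2P gen2]]] := finite_field_simple_extension psi cardE.
  pose Q := (ext_place full mu_monic size_mu muP genal rho_ker psi_const d0 cardK m_monic
     mP genK rho_beta m2_monic size_m2 m2P gen2 funF).
  exists Q.
    split; first split.
    - exact: ext_place_degree.
    - move=> x; exact: (ext_incl full mu_monic size_mu muP rho_ker psi_const).
    - by rewrite -psi_zeta; exact: ext_place_beta.
  by move=> Q' [_ QP'] Qc'; apply: ext_place_unique => //; rewrite psi_zeta.
have -> : (if (d %| r)%N then d else 0%N) = #|[set c | root (map_poly (ce_base E) m) c]%SET|.
  by rewrite (card_conjugate_roots (ce_base E) cardK (ce_card E) d0 m_monic size_m mP genK).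
apply: (@card_eq_trans _ _ _ _ roots).
  rewrite card_eq_sym.
  have -> : roots = res @` degree_one_places_above P.
    apply/seteqP; split=> [c rc|_ [Q QP <-]]; last by have [] := resP Q QP.
    have [Q [QP Qc] _] := exQ c rc; exists Q => //.
    by have [_ /has_residue_uniq] := resP Q QP; apply.
  apply: inj_card_eq => Q Q' /set_mem QP /set_mem QP' EQ.
  have [rc Qc] := resP Q QP; have [_ Qc'] := resP Q' QP'.
  have [Q0 _ Q0P] := exQ _ rc.
  by rewrite (Q0P Q QP Qc) (Q0P Q' QP') // EQ.
pose A := seq_fset tt (enum [set c | root (map_poly (ce_base E) m) c]%SET).
have -> : roots = [set` A].
  by apply/seteqP; split=> c /=; rewrite seq_fsetE mem_enum inE.
apply/card_eq_fsetP; rewrite size_seq_fset undup_id ?enum_uniq //.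
by rewrite cardE.
Qed.

End PlacesAbove.

(** * Counting effective divisors *)

Lemma sum_mem_card (T : choiceType) (S : {fset T}) (p : pred T) (A : set T) n :
  A `<=` [set` S] -> (forall x, x \in S -> p x <-> A x) -> (A #= `I_n)%card ->
  (\sum_(x <- S) p x)%N = n.
Proof.
move=> AS pA /card_fset_set <-.
have finA : finite_set A by exact: sub_finite_set AS (finite_fset S).
rewrite card_fset_sum1 (eq_bigr (fun x => if p x then 1%N else 0%N)); last first.
  by move=> x _; case: (p x).
rewrite -big_mkcond big_fset_condE; apply: eq_fbigl => x.
rewrite in_fset_set // !in_fset /=; apply/andP/idP => [[xS /(pA x xS) Ax]|/set_mem Ax].
  exact/mem_set.
by have xS := AS x Ax; split=> //; apply/pA.
Qed.

Lemma finite_set_inj (T U : Type) (A : set T) (f : T -> U) :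
  {in A &, injective f} -> finite_set (f @` A) -> finite_set A.
Proof.
move=> finj /finite_setP[n fn]; apply/finite_setP; exists n.
by apply: card_eq_trans fn; rewrite card_eq_sym; exact: inj_card_eq.
Qed.

Lemma sum_multiples (f : nat -> nat) (d n : nat) : (0 < d)%N ->
  (\sum_(1 <= i < n.+1) (if (i * d <= n) then f (i * d) else 0) =
   \sum_(1 <= j < n.+1) (if (d %| j) then f j else 0))%N.
Proof.
move=> d0.
transitivity (\sum_(1 <= i < n.+1) \sum_(1 <= j < n.+1) (if j == i * d then f j else 0))%N.
  apply: eq_big_nat => i /andP[i0 _].
  by rewrite -big_mkcond big_nat1_eq muln_gt0 i0 d0 ltnS.
rewrite exchange_big; apply: eq_big_nat => j /andP[j0 jn] /=.
case: ifPn => [/dvdnP[i Ej]|nd]; last first.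
  rewrite big1 // => i _; case: eqP => // E.
  by move: nd; rewrite E dvdn_mull.
under eq_bigr => i' _ do rewrite {1}Ej eqn_pmul2r // eq_sym.
rewrite -big_mkcond big_nat1_eq.
have i0 : (0 < i)%N by move: j0; rewrite Ej muln_gt0 => /andP[].
by rewrite i0 (leq_ltn_trans _ jn) // Ej leq_pmulr.
Qed.

Section Divisors.
Variables (k : finFieldType) (F : fieldType) (iota : {rmorphism k -> F}).
Local Notation place := (place iota).
Implicit Types (D : divisor iota) (P : place).

Definition add_place D P (z : int) : divisor iota := [fsfun D with P |-> D P + z].

Lemma add_placeE D P z Q : add_place D P z Q = D Q + (if Q == P then z else 0).
Proof. by rewrite /add_place fsfun_withE; case: eqP => [->|]; rewrite ?addr0. Qed.

Lemma div_degree_wide D (S : {fset place}) : (finsupp D `<=` S)%fset ->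
  div_degree D = \sum_(P <- S) D P * (place_degree P)%:Z.
Proof.
move=> DS; apply: big_fset_incl => // P _; rewrite memNfinsupp => /eqP ->.
by rewrite mul0r.
Qed.

Lemma div_degree_add D P z :
  div_degree (add_place D P z) = div_degree D + z * (place_degree P)%:Z.
Proof.
pose S := (P |` finsupp D)%fset.
have PS : P \in S by rewrite in_fset1U eqxx.
rewrite !(@div_degree_wide _ S) ?fsubsetUr //; last first.
  rewrite finsupp_with; case: ifP => // _.
  by apply: fsubset_trans (fsubD1set _ _) (fsubsetUr _ _).
rewrite (big_fsetD1 P) // [in RHS](big_fsetD1 P) //=.
rewrite add_placeE eqxx mulrDl -!addrA; congr (_ + _); rewrite addrC; congr (_ + _).
apply: eq_fbigr => Q; rewrite in_fsetD1 => /andP[QP _] _.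
by rewrite add_placeE (negbTE QP) addr0.
Qed.

Lemma add_placeK D P z : add_place (add_place D P z) P (- z) = D.
Proof.
by apply/fsfunP => Q; rewrite !add_placeE; case: eqP => _; rewrite ?addr0 ?addrK.
Qed.

Definition zero_divisor : divisor iota := [fsfun].

Lemma zero_divisorE P : zero_divisor P = 0.
Proof. by rewrite /zero_divisor fsfun0E. Qed.

Lemma div_degree0 : div_degree zero_divisor = 0.
Proof. by rewrite /div_degree finsupp0 big_seq_fset0. Qed.

Definition effective_of_degree (n : nat) : set (divisor iota) :=
  [set D | effective D /\ div_degree D = n%:Z].

Lemma effective_zero_divisor : effective_of_degree 0 zero_divisor.
Proof. by split; [move=> P; rewrite zero_divisorE | exact: div_degree0]. Qed.

Lemma effective_add D P n (i : nat) : effective_of_degree n D ->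
  effective_of_degree (n + i * place_degree P) (add_place D P i).
Proof.
move=> [eD dD]; split; last by rewrite div_degree_add dD PoszD PoszM.
by move=> Q; rewrite add_placeE addr_ge0 //; case: ifP.
Qed.

Variable A : nat -> nat.
Hypothesis zetaA : is_zeta_coefs iota A.

Lemma finite_effective n : finite_set (effective_of_degree n).
Proof. by apply/finite_setP; exists (A n); exact: zetaA. Qed.

(** All multiples of a place of degree 0 would be effective of degree 0, but there
are finitely many such divisors. As the degree defaults to 0, this also says
that residue fields are finite-dimensional over k. *)
Lemma place_degree_gt0 P : (0 < place_degree P)%N.
Proof.
rewrite lt0n; apply/eqP => P0; apply: infinite_nat.
pose f (i : nat) := add_place zero_divisor P i.
apply: (@finite_set_inj _ _ _ f); last first.
  apply: sub_finite_set (finite_effective 0) => _ [i _ <-].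
  have := effective_add P i effective_zero_divisor.
  by rewrite P0 muln0.
move=> i i' _ _ /(congr1 (fun D : divisor iota => D P)).
by rewrite !add_placeE eqxx zero_divisorE !add0r => -[].
Qed.

Lemma effective_term D P n : effective_of_degree n D ->
  D P * (place_degree P)%:Z <= n%:Z.
Proof.
move=> [eD <-]; rewrite (@div_degree_wide _ (P |` finsupp D)%fset) ?fsubsetUr //.
rewrite (big_fsetD1 P) ?in_fset1U ?eqxx //= lerDl.
by apply: sumr_ge0 => Q _; rewrite mulr_ge0.
Qed.

Lemma zeta_coef0 : A 0 = 1%N.
Proof.
have := zetaA 0; rewrite -/(effective_of_degree 0).
suff -> : effective_of_degree 0 = [set zero_divisor].
  move=> H; apply/esym; apply/card_eq_II; apply: (card_eq_trans _ H).
  by rewrite card_eq_sym card_set1.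
apply/seteqP; split=> [D eD|_ ->]; last exact: effective_zero_divisor.
apply/fsfunP => P; rewrite zero_divisorE; apply/eqP.
have := effective_term P eD; have [/(_ P) DP _] := eD; rewrite eq_le DP andbT.
by rewrite pmulr_lle0 // ltz_nat place_degree_gt0.
Qed.

(** A place P is determined by the effective divisor P, whose degree is deg P. *)
Lemma finite_places n : finite_set [set P : place | (place_degree P <= n)%N].
Proof.
have fin : finite_set (\bigcup_(d in `I_n.+1) effective_of_degree d).
  by apply: bigcup_finite => [|d _]; [exact: finite_II | exact: finite_effective].
pose f P := add_place zero_divisor P 1.
apply: (@finite_set_inj _ _ _ f); last first.
  apply: sub_finite_set fin => _ [P Pn <-]; exists (place_degree P) => //.
  by have := effective_add P 1 effective_zero_divisor; rewrite add0n mul1n.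
move=> P P' _ _ /(congr1 (fun D : divisor iota => D P)).
rewrite !add_placeE eqxx zero_divisorE !add0r; case: eqP => // ->.
Qed.

Definition places_upto n : {fset place} := fset_set [set P : place | (place_degree P <= n)%N].

Lemma mem_places_upto n P : (P \in places_upto n) = (place_degree P <= n)%N.
Proof. by rewrite in_fset_set; [apply/idP/idP => [/set_mem|/mem_set] | exact: finite_places]. Qed.

(** Adding i P is a bijection from the effective divisors of degree n - i deg P. *)
Lemma card_effective_multiplicity n P (i : nat) :
  ([set D | effective_of_degree n D /\ i%:Z <= D P] #=
   `I_(if i * place_degree P <= n then A (n - i * place_degree P) else 0)%N)%card.
Proof.
case: leqP => le; last first.
  rewrite II0 card_eq0; apply/eqP/seteqP; split=> // D [eD iD].
  have := effective_term P eD; apply/negP; rewrite -ltNge.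
  by apply: lt_le_trans (ler_wpM2r _ iD); rewrite ?ltz_nat.
rewrite -(card_eqr (zetaA _)) card_eq_sym.
have -> : [set D | effective_of_degree n D /\ i%:Z <= D P] =
    (fun D => add_place D P i) @` effective_of_degree (n - i * place_degree P).
  apply/seteqP; split=> [D [[eD dD] iD]|_ [D eD <-]]; last first.
    split; last by rewrite add_placeE eqxx lerDr; case: eD.
    by have := effective_add P i eD; rewrite subnK.
  exists (add_place D P (- i%:Z)); last by rewrite -[X in add_place _ _ X]opprK add_placeK.
  split; last by rewrite div_degree_add dD mulNr -PoszM subzn.
  move=> Q; rewrite add_placeE; case: eqP => [->|_]; last by rewrite addr0; exact: eD.
  by rewrite subr_ge0.
rewrite card_eq_sym; apply: inj_card_eq => D D' _ _ E.
by rewrite -(add_placeK D P i) E add_placeK.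
Qed.

(** Both sides count the triples of an effective divisor D of degree n, a place P,
and an integer 1 <= i <= D P, weighted by deg P; on the right j = i deg P. *)
Lemma zeta_recursion n :
  (n * A n = \sum_(1 <= j < n.+1)
    (\sum_(P <- places_upto n) (if place_degree P %| j then place_degree P else 0)) * A (n - j))%N.
Proof.
pose En := fset_set (effective_of_degree n).
have memEn D : (D \in En) = `[< effective_of_degree n D >].
  by rewrite in_fset_set //; exact: finite_effective.
have -> : (n * A n = \sum_(D <- En) n)%N.
  have <- : #|` En|%fset = A n by exact/card_fset_set/zetaA.
  by rewrite big_const_seq count_predT iter_addn_0.
transitivity (\sum_(D <- En) \sum_(P <- places_upto n)
  place_degree P * \sum_(1 <= i < n.+1) (i%:Z <= D P)%R)%N.
  rewrite big_seq [RHS]big_seq; apply: eq_bigr => D; rewrite memEn => /asboolP eD.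
  have [eD0 dD] := eD.
  have sD : (finsupp D `<=` places_upto n)%fset.
    apply/fsubsetP => P; rewrite mem_finsupp mem_places_upto => DP0.
    rewrite -lez_nat; apply: le_trans (effective_term P eD).
    have : 1 <= D P by move: DP0 (eD0 P); case: (D P) => [[|?]|?].
    by move=> D1; rewrite -[X in X <= _]mul1r ler_wpM2r.
  apply/eqP; rewrite -eqz_nat -{1}dD (div_degree_wide sD) (big_morph Posz PoszD (erefl 0%:Z)).
  apply/eqP; apply: eq_bigr => P _; rewrite PoszM mulrC; congr (_ * _).
  have [c Dc] : exists c : nat, D P = c by case: (D P) (eD0 P) => // c _; exists c.
  have cn : (c <= n)%N.
    have := effective_term P eD; rewrite Dc -PoszM lez_nat => H.
    by apply: leq_trans H; rewrite leq_pmulr // place_degree_gt0.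
  rewrite Dc; congr Posz.
  under eq_bigr => i _ do rewrite lez_nat.
  rewrite (big_cat_nat (n := c.+1)) //= [X in (_ + X)%N]big_nat_cond.
  rewrite [X in (_ + X)%N]big1; last first.
    by move=> i /andP[/andP[ci _] _]; rewrite leqNgt ci.
  rewrite addn0 (eq_big_nat _ _ (F2 := fun=> 1%N)) ?sum_nat_const_nat ?muln1 ?subn1 //.
  by move=> i /andP[_]; rewrite ltnS => ->.
rewrite exchange_big /=.
transitivity (\sum_(P <- places_upto n)
  place_degree P * \sum_(1 <= j < n.+1) (if place_degree P %| j then A (n - j) else 0))%N.
  apply: eq_bigr => P _; rewrite -big_distrr /= exchange_big /=; congr (_ * _)%N.
  rewrite -sum_multiples ?place_degree_gt0 //; apply: eq_bigr => i _.
  apply: (sum_mem_card _ _ (card_effective_multiplicity n P i)).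
    by move=> D [eD _] /=; rewrite memEn; apply/asboolP.
  by move=> D; rewrite memEn => /asboolP eD; split=> [|[]].
under eq_bigr => P _ do rewrite big_distrr.
rewrite exchange_big; apply: eq_bigr => j _ /=.
rewrite big_distrl; apply: eq_bigr => P _ /=.
by case: ifP; rewrite ?muln0 ?mul0n.
Qed.

End Divisors.

Section DegreeOneCount.
Variables (k : finFieldType) (F : fieldType) (iota : {rmorphism k -> F}).
Hypothesis full : is_full_constant_field iota.
Hypothesis funF : is_function_field iota.
Variable A : nat -> nat.
Hypothesis zetaA : is_zeta_coefs iota A.

(** Sort the places of degree one by the place of F below them; its degree
divides r, so it is among the places counted on the left. *)
Lemma sum_degree_dvd_num_degree_one_places (r n N : nat) : (0 < r <= n)%N ->
  is_num_degree_one_places iota r N ->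
  (\sum_(P <- places_upto iota n) (if place_degree P %| r then place_degree P else 0))%N = N.
Proof.
move=> /andP[r0 rn] [E cardT].
set T := [set Q | _] in cardT.
have finT : finite_set T by apply/finite_setP; exists N.
have memT Q : (Q \in fset_set T) = `[< T Q >] by rewrite in_fset_set.
have /choice[below belowP] := place_below_ex full (E := E).
have aboveE P Q : T Q -> (below Q == P) <-> degree_one_places_above P Q.
  move=> TQ; split=> [/eqP<-|[_ QP]]; first by split => //; exact: belowP.
  apply/eqP/place_eq/seteqP; split=> x; first by move/belowP/QP.
  by move/QP/belowP.
rewrite -(card_fset_set cardT) card_fset_sum1.
transitivity (\sum_(Q <- fset_set T) \sum_(P <- places_upto iota n) (below Q == P))%N; last first.
  rewrite big_seq [RHS]big_seq; apply: eq_bigr => Q; rewrite memT => /asboolP TQ.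
  have bn : below Q \in places_upto iota n.
    rewrite (mem_places_upto zetaA).
    have [/dvdn_leq H|nd] := boolP (place_degree (below Q) %| r)%N.
      by rewrite (leq_trans _ rn) // H.
    have := card_degree_one_places_above E full funF (place_degree_gt0 zetaA (below Q)).
    rewrite (negbTE nd) II0 card_eq0 => /eqP /seteqP[+ _] => /(_ Q) [].
    exact/aboveE.
  rewrite (big_fsetD1 _ bn) eqxx big1_fset // => P.
  by rewrite in_fsetD1 eq_sym => /andP[/negbTE-> _].
rewrite exchange_big; apply: eq_bigr => P _ /=.
apply/esym/(sum_mem_card _ _ (card_degree_one_places_above E full funF (place_degree_gt0 zetaA P))).
  by move=> Q [Q1 _] /=; rewrite memT; apply/asboolP.
by move=> Q; rewrite memT => /asboolP; exact: aboveE.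
Qed.

End DegreeOneCount.

(** * Newton identities *)

Section PowerSums.

Definition shift_seq (f : nat -> rat) (n : nat) : rat := if n is n'.+1 then f n' else 0.

(** The generating series satisfy t f'(t) = p(t) f(t), p starting at t^1. *)
Definition newton_identities (f p : nat -> rat) : Prop :=
  forall n, n%:R * f n = \sum_(1 <= j < n.+1) p j * f (n - j)%N.

(** The logarithmic derivative of 1 - c t contributes - sum of c^j t^j: by the
product rule, the geometric series against f(t) (1 - c t) telescopes. *)
Lemma newton_identities_mul_linear (f p : nat -> rat) (c : rat) : newton_identities f p ->
  newton_identities (fun n => f n - c * shift_seq f n) (fun j => p j - c ^+ j).
Proof.
move=> fp n.
have shiftN : n%:R * shift_seq f n - shift_seq f n =
    \sum_(1 <= j < n.+1) p j * shift_seq f (n - j)%N.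
  case: n => [|n]; first by rewrite mul0r subrr big_geq.
  rewrite big_nat_recr //= subnn mulr0 addr0 -[in LHS]natr1 mulrDl mul1r addrK fp.
  by apply: eq_big_nat => j /andP[_ jn]; rewrite subSn.
have tel : \sum_(1 <= j < n.+1) (c ^+ j * f (n - j)%N - c ^+ j.+1 * shift_seq f (n - j)%N) =
    c * shift_seq f n.
  pose G j := - (c ^+ j * shift_seq f (n.+1 - j)).
  transitivity (\sum_(1 <= j < n.+1) (G j.+1 - G j)).
    apply: eq_big_nat => j /andP[_ jn].
    by rewrite /G subSS opprK addrC subSn.
  by rewrite telescope_sumr // /G subnn mulr0 oppr0 sub0r opprK subSS subn0 expr1.
transitivity (\sum_(1 <= j < n.+1) p j * f (n - j)%N
   - c * \sum_(1 <= j < n.+1) p j * shift_seq f (n - j)%N - c * shift_seq f n).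
  by rewrite -fp -shiftN; ring.
rewrite -tel mulr_sumr -!sumrB; apply: eq_big_nat => j _.
by rewrite exprS; ring.
Qed.

Lemma L_coefficient (q : rat) (f : nat -> rat) n :
  \sum_(j < n.+1) ((1 - 'X) * (1 - q *: 'X) : {poly rat})`_j * f (n - j)%N =
  f n - 1 * shift_seq f n - q * shift_seq (fun n => f n - 1 * shift_seq f n) n.
Proof.
have -> : (1 - 'X) * (1 - q *: 'X) = 1 - (1 + q) *: 'X + q *: 'X^2 :> {poly rat}.
  by rewrite -!mul_polyC rmorphD rmorph1; ring.
have cf j : (1 - (1 + q) *: 'X + q *: 'X^2 : {poly rat})`_j =
    (j == 0)%:R - (1 + q) * (j == 1)%:R + q * (j == 2)%:R.
  by rewrite !coefE.
under eq_bigr => j _ do rewrite cf.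
case: n => [|[|n]].
- by rewrite big_ord1 subn0 /=; ring.
- by rewrite !big_ord_recl big_ord0 /=; ring.
rewrite !big_ord_recl big1 => [|j _] /=; last by rewrite !mulr0 subr0 addr0 mul0r.
by rewrite !subSS !subn0; ring.
Qed.

End PowerSums.

(** * Sums over compositions *)

Section Compositions.
Variable S : nat -> rat.

(** The compositions of n, sorted by their last part j. The fuel bounds the
recursion, which is not structural; any fuel >= n gives the same list up to
order. The empty sequence is the composition of 0. *)
Fixpoint comps (fuel n : nat) : seq (seq nat) :=
  if n == 0%N then [:: [::]] else
  if fuel is f.+1 then
    [seq rcons m j | j <- iota 1 n, m <- comps f (n - j)]
  else [::].

Lemma mem_comps fuel n m : (n <= fuel)%N ->
  (m \in comps fuel n) = all (fun x => 0 < x)%N m && (sumn m == n).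
Proof.
elim: fuel n m => [|f IH] n m.
  rewrite leqn0 => /eqP->; rewrite /= inE.
  by case: m => [|x m] //=; rewrite addn_eq0; case: x => //=; rewrite andbF.
case: n => [_|n nf].
  rewrite /= inE; case: m => [|x m] //=; rewrite addn_eq0; case: x => //=.
  by rewrite andbF.
have -> : comps f.+1 n.+1 = [seq rcons m j | j <- iota 1 n.+1, m <- comps f (n.+1 - j)] by [].
have le j : (1 <= j)%N -> (n.+1 - j <= f)%N by lia.
apply/allpairsPdep/idP => [[j [m' [jr mr ->]]]|].
  move: jr mr; rewrite mem_iota => /andP[j1 jn]; rewrite IH ?le // => /andP[pm /eqP sm].
  by rewrite all_rcons sumn_rcons pm j1 sm /=; apply/eqP; lia.
case/lastP: m => [|m j]; first by [].
rewrite all_rcons sumn_rcons => /andP[/andP[j0 pm] /eqP sm].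
exists j, m; split=> //; first by rewrite mem_iota j0 /=; lia.
by rewrite IH ?le // pm -sm addnK eqxx.
Qed.

Lemma uniq_comps fuel n : uniq (comps fuel n).
Proof.
elim: fuel n => [|f IH] [|n] //.
have -> : comps f.+1 n.+1 = [seq rcons m j | j <- iota 1 n.+1, m <- comps f (n.+1 - j)] by [].
apply: allpairs_uniq_dep => [|j _|]; [exact: iota_uniq | exact: IH|].
by move=> [j m] [j' m'] _ _ /= /rcons_inj[-> ->].
Qed.

Definition comp_weight (m : seq nat) : rat :=
  \prod_(s < size m) (S (nth 0%N m s) / (psum m s.+1)%:R).

Lemma comp_weight_rcons m j :
  comp_weight (rcons m j) = comp_weight m * (S j / (sumn (rcons m j))%:R).
Proof.
rewrite /comp_weight size_rcons big_ord_recr /=; congr (_ * _).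
  apply: eq_bigr => s _; rewrite /psum nth_rcons ltn_ord.
  by rewrite -cats1 takel_cat // ltn_ord.
by rewrite /psum nth_rcons ltnn eqxx take_oversize // size_rcons.
Qed.

Definition comp_sum n : rat := \sum_(m <- comps n n) comp_weight m.

Lemma comps_fuel fuel n (G : seq nat -> rat) : (n <= fuel)%N ->
  \sum_(m <- comps fuel n) G m = \sum_(m <- comps n n) G m.
Proof.
move=> nf; apply: perm_big; apply: uniq_perm; rewrite ?uniq_comps // => m.
by rewrite !mem_comps.
Qed.

(** The last part j of a composition of n contributes the factor S_j / n, and what
remains is a composition of n - j. *)
Lemma comp_sum_newton_identities : newton_identities comp_sum S.
Proof.
case=> [|n]; first by rewrite mul0r big_geq.
rewrite {1}/comp_sum.
have -> : comps n.+1 n.+1 = [seq rcons m j | j <- iota 1 n.+1, m <- comps n (n.+1 - j)] by [].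
rewrite big_allpairs_dep mulr_sumr -[iota 1 n.+1]/(index_iota 1 n.+2).
apply: eq_big_nat => j /andP[j1 jn].
rewrite /comp_sum -(@comps_fuel n); last by lia.
rewrite !mulr_sumr big_seq [RHS]big_seq; apply: eq_bigr => m.
rewrite mem_comps => [/andP[_ /eqP sm]|]; last by lia.
rewrite comp_weight_rcons sumn_rcons sm subnK; last by lia.
by rewrite mulrCA [S j / _]mulrC mulVKf ?pnatr_eq0 // mulrC.
Qed.

Lemma newton_identities_unique (f g p : nat -> rat) n : f 0%N = g 0%N ->
  (forall i, (i <= n)%N -> i%:R * f i = \sum_(1 <= j < i.+1) p j * f (i - j)%N) ->
  newton_identities g p -> forall i, (i <= n)%N -> f i = g i.
Proof.
move=> fg0 fp gp i; elim/ltn_ind: i => -[|i] IH // le.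
have i0 : (i.+1%:R : rat) != 0 by rewrite pnatr_eq0.
apply: (mulfI i0); rewrite fp // gp; apply: eq_big_nat => j /andP[j1 jn].
by rewrite IH //; lia.
Qed.

Lemma compositionsE n : (0 < n)%N -> compositions n = [set` comps n n].
Proof.
move=> n0; apply/seteqP; split=> m /=; rewrite mem_comps //.
  by move=> [_ -> ->]; rewrite eqxx.
by move=> /andP[pm /eqP sm]; split=> // m0; move: n0; rewrite -sm m0.
Qed.

Lemma sum_compositions n (G : seq nat -> rat) : (0 < n)%N ->
  \sum_(m \in compositions n) G m = \sum_(m <- comps n n) G m.
Proof. by move=> n0; rewrite compositionsE // -fsbig_seq // uniq_comps. Qed.

Lemma size_comps n m : m \in comps n n -> (size m <= n)%N.
Proof.
rewrite mem_comps // => /andP[+ /eqP <-].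
by elim: m => //= x m IH /andP[x0 /IH]; lia.
Qed.

(** The row index of a factorial product is a partial sum of the composition, and
the difference of its indices is a part. *)
Lemma pper_cancelledE n : (0 < n)%N -> pper_cancelled n S = comp_sum n.
Proof.
move=> n0; rewrite /pper_cancelled /pper_of_factorial_products -[n == 0%N]leqn0 leqNgt n0 /=.
transitivity (\sum_(1 <= r < n.+1) \sum_(m <- comps n n | size m == r) comp_weight m).
  apply: eq_bigr => r _; rewrite -[RHS]big_filter [RHS]fsbig_seq ?filter_uniq ?uniq_comps //.
  have -> : [set m | compositions n m /\ size m = r] = [set` [seq m <- comps n n | size m == r]].
    rewrite compositionsE //; apply/seteqP; split=> m /=; rewrite mem_filter.
      by move=> [-> ->]; rewrite eqxx.
    by move=> /andP[/eqP -> ->].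
  apply: eq_fsbigr => m /set_mem /=; rewrite mem_filter => /andP[/eqP <- _].
  apply: eq_bigr => s _; rewrite /cancelled_products.
  have -> : psum m s.+1 = (psum m s + nth 0%N m s)%N.
    by rewrite /psum (take_nth 0%N) // sumn_rcons.
  by rewrite subSS addKn.
rewrite (exchange_big_dep predT) //= /comp_sum big_seq [RHS]big_seq.
apply: eq_bigr => m mc.
have ms : (0 < size m <= n)%N.
  rewrite size_comps // andbT; case: m mc => //; rewrite mem_comps //=.
  by move=> /eqP E; move: n0; rewrite -E.
rewrite (eq_bigl (fun r => r == size m)) => [|r]; last by rewrite eq_sym.
by rewrite big_nat1_eq ltnS ms.
Qed.

End Compositions.

Lemma sum_int_ext (S a : nat -> rat) (i : nat) :
  \sum_(j \in [set j : nat | (1 <= j)%N]) S j * int_ext a (i%:Z - j%:Z) =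
  \sum_(1 <= j < i.+1) S j * a (i - j)%N.
Proof.
rewrite (fsbigE (index_iota 1 i.+1)) ?iota_uniq //.
- rewrite big_nat_cond [RHS]big_nat_cond; apply: eq_big => [j|j].
    by rewrite andbT; apply/andP/idP => [[]|/andP[j1 ->]] //; rewrite j1; split=> //; exact/mem_set.
  by move=> /andP[/andP[j1 jn] _]; rewrite subzn.
- by move=> j /=; rewrite mem_index_iota => /andP[].
- move=> j /= j1; rewrite mem_index_iota j1 /= -leqNgt => ij.
  have -> : i%:Z - j%:Z = Negz (j - i).-1 by lia.
  by rewrite mulr0.
Qed.

(** * Coefficients of the L-polynomial *)

Section LPolynomial.
Variables (k : finFieldType) (F : fieldType) (iota : {rmorphism k -> F}).
Variables (g : nat) (a : nat -> rat) (N : nat -> nat) (S : nat -> rat).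
Hypothesis funF : is_function_field iota.
Hypothesis full : is_full_constant_field iota.
Hypothesis hL : is_L_polynomial iota #|k| (\poly_(i < (2 * g).+1) a i).
Hypothesis hN : forall r, (1 <= r)%N -> is_num_degree_one_places iota r (N r).
Hypothesis hS : forall r, (1 <= r)%N -> S r = (N r)%:R - ((#|k| ^ r)%N%:R + 1).

(** Two multiplications by linear factors turn the recursion for the coefficients
of the Zeta function, driven by N_j, into one for those of L, driven by S_j;
this recursion determines the a_i from a_0 = 1. *)
Lemma L_coefficients_eq_comp_sum i : (i <= 2 * g)%N -> a i = comp_sum S i.
Proof.
have [A zetaA LA] := hL.
pose f n : rat := (A n)%:R.
have fN : newton_identities f (fun j => (N j)%:R).
  move=> n; rewrite /f -natrM (zeta_recursion zetaA) natr_sum.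
  apply: eq_big_nat => j /andP[j1 jn]; rewrite natrM; congr (_%:R * _).
  by apply: (sum_degree_dvd_num_degree_one_places full funF zetaA _ (hN j1)); rewrite j1.
have := newton_identities_mul_linear #|k|%:R (newton_identities_mul_linear 1 fN).
set h := fun n => _ => hNewton.
have ha n : (n <= 2 * g)%N -> a n = h n.
  by move=> le; have := LA n; rewrite coef_poly ltnS le => ->; exact: (L_coefficient _ f).
move=> le; rewrite ha //.
apply: (@newton_identities_unique _ _ S (2 * g)) le; last exact: comp_sum_newton_identities.
  rewrite /h /= /f (zeta_coef0 zetaA) /comp_sum /= big_seq1 /comp_weight big_ord0.
  by rewrite !mulr0 !subr0.
move=> n _; rewrite hNewton; apply: eq_big_nat => j /andP[j1 _].
by rewrite hS // expr1n natrX -addrA opprD; congr (_ * _); ring.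
Qed.

End LPolynomial.

Unset Implicit Arguments.

Theorem theorem3p1 (q g : nat) (k : finFieldType) (F : fieldType)
    (iota : {rmorphism k -> F}) (a : nat -> rat) (N : nat -> nat)
    (S : nat -> rat)
    (hq : #|k| = q)
    (hF : is_function_field iota)
    (hk : is_full_constant_field iota)
    (hg : is_genus iota g)
    (hL : is_L_polynomial iota q (\poly_(i < (2 * g).+1) a i))
    (hN : forall r, (1 <= r)%N -> is_num_degree_one_places iota r (N r))
    (hS : forall r, (1 <= r)%N -> S r = (N r)%:R - ((q ^ r)%N%:R + 1))
    (i : nat) (hi : (1 <= i <= g)%N) :
  [<->
    (* (a) *)
    a i = (i%:R^-1 : rat) *
      \sum_(j \in [set j : nat | (1 <= j)%N]) S j * int_ext a (i%:Z - j%:Z);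
    (* (b) *)
    a i = pper_cancelled i S;
    (* (c) *)
    a i = \sum_(m \in compositions i)
            \prod_(s < size m) (S (nth 0%N m s) / (psum m s.+1)%:R) /\
    \sum_(m \in compositions i)
      \prod_(s < size m) (S (nth 0%N m s) / (psum m s.+1)%:R) =
    \sum_(m \in compositions i)
      \prod_(s < size m)
        (((N (nth 0%N m s))%:R - ((q ^ nth 0%N m s)%N%:R + 1) : rat)
           / (psum m s.+1)%:R)
  ].
Proof.
have /andP[i0 ig] := hi.
rewrite -hq in hL hS *.
have aE n : (n <= i)%N -> a n = comp_sum S n.
  by move=> ni; apply: (L_coefficients_eq_comp_sum hF hk hL hN hS); lia.
have Pa : a i = (i%:R^-1 : rat) *
    \sum_(j \in [set j : nat | (1 <= j)%N]) S j * int_ext a (i%:Z - j%:Z).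
  rewrite sum_int_ext; apply: (mulfI (x := i%:R)); first by rewrite pnatr_eq0 -lt0n.
  rewrite mulrA mulfV ?mul1r ?pnatr_eq0 -?lt0n // aE // comp_sum_newton_identities.
  by apply: eq_big_nat => j _; rewrite aE ?leq_subr.
have Pb : a i = pper_cancelled i S by rewrite pper_cancelledE // aE.
have Pc : a i = \sum_(m \in compositions i)
    \prod_(s < size m) (S (nth 0%N m s) / (psum m s.+1)%:R).
  by rewrite sum_compositions // aE.
tfae => // _; split=> //.
apply: eq_fsbigr => m /set_mem[_ /allP pm _]; apply: eq_bigr => s _.
by rewrite hS // pm // mem_nth.
Qed.
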